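(* There exist two positive absolute constants $c,C$ such that for any positive integer $n$, any $L>0$, and any orthonormal system $(\varphi_j)_{j=1}^n$ in $L_2$ with $\|\varphi_j\|_{L_\infty}\le L$ for $1\le j\le n$, the following holds. 1) For any integer $k$ with $1<k<n$ there exists a subset $I\subset\{1,\ldots,n\}$ with $|I|\ge n-k$ such that for every $a=(a_i)\in\mathbb{C}^n$, $$ \left\|\sum_{i\in I}a_i\varphi_i\right\|_{L_2}\le C\,\mu\,(\log\mu)^{5/2}\left\|\sum_{i\in I}a_i\varphi_i\right\|_{L_1}, $$ where $\mu=L\sqrt{n/k}\,\sqrt{\log k}$. 2) Moreover, if $n\ge4$ is an even integer, there exists a subset $I\subset\{1,\ldots,n\}$ with $n/2-c\sqrt n\le|I|\le n/2+c\sqrt n$ such that for every $a=(a_i)\in\mathbb{C}^n$, $$ \left\|\sum_{i\in I}a_i\varphi_i\right\|_{L_2}\le C\,L\,\sqrt{\log n}\,(\log\log n)^{5/2}\left\|\sum_{i\in I}a_i\varphi_i\right\|_{L_1} $$ and $$ \left\|\sum_{i\notin I}a_i\varphi_i\right\|_{L_2}\le C\,L\,\sqrt{\log n}\,(\log\log n)^{5/2}\left\|\sum_{i\notin I}a_i\varphi_i\right\|_{L_1}. $$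
   Context: Here $L_p$ ($1\le p\le\infty$) denotes the space of complex-valued $p$-integrable functions (essentially bounded for $p=\infty$) on a probability space, with its usual norm. In the second inequality of part 2, $i\notin I$ means $i\in\{1,\ldots,n\}\setminus I$. The constants $c,C$ do not depend on $n$, $k$, $L$, the probability space or the system. *)

(* Defs.v *)
From HB Require Import structures.
From mathcomp Require Import all_boot all_order all_algebra.
From mathcomp Require Import complex.
From mathcomp Require Import all_classical all_reals all_analysis.
Set Implicit Arguments.
Unset Strict Implicit.
Unset Printing Implicit Defensive.
Import Order.TTheory GRing.Theory Num.Theory.
Import numFieldNormedType.Exports.
Local Open Scope ring_scope.
Local Open Scope complex_scope.
Local Open Scope classical_set_scope.

(* Elements of L_p are represented by functions, not by classes modulo
   almost-everywhere equality. *)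
Section ComplexLp.
Context {d : measure_display} {T : measurableType d} {R : realType}.
Variable P : probability T R.

(* The library has no Borel sigma-algebra on R[i]; identifying R[i] with R^2,
   Borel measurability amounts to measurability of both coordinates. *)
Definition cmeasurable (f : T -> R[i]) : Prop :=
  measurable_fun [set: T] (fun x => complex.Re (f x)) /\
  measurable_fun [set: T] (fun x => complex.Im (f x)).

Definition cLnorm (p : \bar R) (f : T -> R[i]) : \bar R :=
  Lnorm P p (fun x => (Normc.normc (f x))%:E).

Definition in_cL (p : \bar R) (f : T -> R[i]) : Prop :=
  cmeasurable f /\ (cLnorm p f < +oo)%E.

(* Only meaningful for integrable f: [Rintegral] is 0 when the extended
   integral is infinite. *)
Definition cintegral (f : T -> R[i]) : R[i] :=
  Rintegral P [set: T] (fun x => complex.Re (f x)) +i*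
  Rintegral P [set: T] (fun x => complex.Im (f x)).

Definition orthonormal_system (n : nat) (phi : 'I_n -> T -> R[i]) : Prop :=
  (forall j, in_cL 2%:E (phi j)) /\
  (forall i j, cintegral (fun x => phi i x * (phi j x)^*) = (i == j)%:R).

Definition partial_sum (n : nat) (phi : 'I_n -> T -> R[i]) (I : {set 'I_n})
    (a : 'I_n -> R[i]) : T -> R[i] :=
  fun x => \sum_(i in I) a i * phi i x.

End ComplexLp.

(* Main.v *)
Require Import Defs.
From HB Require Import structures.
From mathcomp Require Import all_boot all_order all_algebra.
From mathcomp Require Import complex.
From mathcomp Require Import all_classical all_reals all_analysis.
From mathcomp Require Import measurable_realfun ess_sup_inf.
From mathcomp Require Import zify ring lra.
Set Implicit Arguments.
Unset Strict Implicit.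
Unset Printing Implicit Defensive.
Import Order.TTheory GRing.Theory Num.Theory.
Import numFieldNormedType.Exports.
Local Open Scope ring_scope.
Local Open Scope complex_scope.
Local Open Scope classical_set_scope.

(* Write f = sum_i a_i phi_i with |f|_1 = 1 and suppose that a vanishes on a set J.
   Entropic mirror descent (the potential is ln (1 + L^2 E (cosh - 1)), whose
   curvature in the directions phi_i is at most L^2) approximates f greedily: a step
   correcting a coefficient error tau gains about tau^2 / L^2, whereas the total gain
   is at most ln 2 + ln (1 + |f|_2^2 / L^2), by a Fenchel-Young inequality.  After t
   steps the iterate is determined by t letters of an alphabet of size O(n^2), so a
   random J of density k/n meets, with positive probability for all t at once, every
   set of at least M (t + 1) indices, M ~ (n/k) log n, of the form
   {i | coefficient i of an iterate after t steps is > tau}.  As a = 0 on J, the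
   decreasing rearrangement u of |a| then allows step t to gain u_{M (t+1)}^2 / L^2
   up to a constant.  Summing over t gives
   |f|_2^2 <= C L^2 M log (2 + |f|_2^2 / L^2), with a total gain in which no scale is
   counted twice, hence |f|_2 <= C L sqrt (M log M) |f|_1. *)

(** * Hyperbolic functions *)

Section HyperbolicInequalities.
Context {R : realType}.
Implicit Types x y a b w : R.

Definition cosh x : R := (expR x + expR (- x)) / 2.
Definition sinh x : R := (expR x - expR (- x)) / 2.

Lemma cosh0 : cosh 0 = 1.
Proof. by rewrite /cosh oppr0 expR0; lra. Qed.

Lemma cosh_ge1 x : 1 <= cosh x.
Proof.
have e0 := expR_gt0 x; have m := expRxMexpNx_1 x.
have h : 2 <= expR x + expR (- x).
  by rewrite -(ler_pM2l e0) [leRHS]mulrDr m; have := sqr_ge0 (expR x - 1); lra.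
by rewrite /cosh; lra.
Qed.

(** From [1 - y / 2 <= expR (- (y / 2))], squaring gives [expR y * (1 - y / 2) ^+ 2 <= 1], while
    [(1 + y + y ^+ 2) * (1 - y / 2) ^+ 2] exceeds 1 by [y ^+ 2 * (1 - 3 * y + y ^+ 2) / 4]. *)
Lemma expR_le_quadratic y : `|y| <= 3^-1 -> expR y <= 1 + y + y ^+ 2.
Proof.
rewrite ler_norml => /andP[y1 y2].
have h1 : 1 + - (y / 2) <= expR (- (y / 2)) by exact: expR_ge1Dx.
have h2 : expR y * expR (- (y / 2)) ^+ 2 = 1.
  rewrite expr2 -!expRD (_ : _ + _ = 0) ?expR0 //; by field.
have e0 := expR_gt0 y.
have h3 : (1 - y / 2) ^+ 2 <= expR (- (y / 2)) ^+ 2.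
  by rewrite ler_sqr ?nnegrE //; lra.
have h4 : expR y * (1 - y / 2) ^+ 2 <= 1 by rewrite -[leRHS]h2 ler_pM2l.
have h5 : 1 <= (1 + y + y ^+ 2) * (1 - y / 2) ^+ 2.
  have -> : (1 + y + y ^+ 2) * (1 - y / 2) ^+ 2 =
            1 + y ^+ 2 * (1 - 3 * y + y ^+ 2) / 4 by field.
  rewrite lerDl divr_ge0 // mulr_ge0 ?sqr_ge0 //.
  by have := sqr_ge0 y; lra.
rewrite -(@ler_pM2r _ ((1 - y / 2) ^+ 2)) ?(le_trans h4) //.
by rewrite exprn_gt0 //; lra.
Qed.

Lemma coshD_le x y : `|y| <= 3^-1 ->
  cosh (x + y) <= cosh x + sinh x * y + cosh x * y ^+ 2.
Proof.
move=> hy; rewrite /cosh /sinh opprD !expRD.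
have h1 := expR_le_quadratic hy.
have h2 : expR (- y) <= 1 - y + y ^+ 2.
  by rewrite -(sqrrN y); apply: expR_le_quadratic; rewrite normrN.
have e1 := expR_gt0 x; have e2 := expR_gt0 (- x).
have := ler_wpM2l (ltW e1) h1; have := ler_wpM2l (ltW e2) h2.
lra.
Qed.

Lemma ln_leB1 y : 0 < y -> ln y <= y - 1.
Proof.
by move=> y0; rewrite -{1}(subrKC 1 y) le_ln1Dx //; lra.
Qed.

(* Pointwise Fenchel-Young inequality between [cosh - 1] and an entropy of
   [a]; the free parameters are optimised after integration. *)
Lemma mul_le_cosh_entropy (a x b w c : R) : 0 < b -> 0 < w -> 0 < c ->
  a * x <= `|a| * (- ln w + ln c - 2) + (`|a| + a ^+ 2 / b) / c
           + 2 * w * (`|a| + b * (cosh x - 1)).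
Proof.
move=> b0 w0 c0.
apply: (le_trans (ler_norm _)); rewrite normrM -[a ^+ 2]real_normK ?num_real //.
have -> : cosh x = cosh `|x|.
  by case: (ler0P x) => _ //; rewrite /cosh opprK addrC.
move: `|a| (normr_ge0 a) `|x| (normr_ge0 x) => {}a a0 {}x x0.
(* Tangent lines of [ln] are used twice: at [c] for [ln d], and at 1 for [ln (expR x * w / d)]. The
   quotient [a / d] is at most both [a] and [b], which linearises the exponential term. *)
set d := 1 + a / b; have d1 : 1 <= d by rewrite lerDl divr_ge0 // ltW.
have d0 : 0 < d by lra.
have hd : ln d <= ln c + d / c - 1.
  have := ln_leB1 (divr_gt0 d0 c0); rewrite ln_div ?posrE //; lra.
have e0 := expR_gt0 x.
have hx : x <= - ln w + ln d + expR x * w / d - 1.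
  have ew0 := mulr_gt0 e0 w0.
  have := ln_leB1 (divr_gt0 ew0 d0).
  by rewrite ln_div ?lnM ?posrE ?expRK //; lra.
have hx' : x <= - ln w + (ln c + d / c - 1) + expR x * w / d - 1 by lra.
apply: (le_trans (ler_wpM2l a0 hx')).
have ec : expR x <= 2 * cosh x.
  by rewrite /cosh; have := expR_gt0 (- x); lra.
have ch1 := cosh_ge1 x.
have had : a / d <= b.
  by rewrite ler_pdivrMr // /d mulrDr mulr1 mulrCA mulfV ?mulr1 ?gt_eqF // lerDr ltW.
have had' : a / d <= a by rewrite ler_pdivrMr // ler_peMr.
have ad0 : 0 <= a / d by rewrite divr_ge0 // ltW.
have k1 : a * (expR x * w / d) <= 2 * w * (a + b * (cosh x - 1)).
  have -> : a * (expR x * w / d) = w * (a / d * expR x) by field; rewrite gt_eqF.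
  rewrite (mulrC 2) -(mulrA w 2) ler_pM2l //.
  apply: (@le_trans _ _ (a / d * (2 * cosh x))); first exact: ler_wpM2l.
  have := ler_wpM2r (_ : 0 <= cosh x - 1) had; rewrite subr_ge0 => /(_ ch1); lra.
have k2 : a * (d / c) = (a + a ^+ 2 / b) / c.
  by rewrite /d; field; rewrite !gt_eqF.
by lra.
Qed.

End HyperbolicInequalities.

(** * Bounded functions and the entropic potential *)

Section BoundedFunctions.
Context d (T : measurableType d) (R : realType) (P : probability T R).
Implicit Types (f g h : T -> R) (r : R).

(** Boundedness holds at every point, so the class is stable under [expR], [cosh], [sinh] and
    products, and all its members are integrable. *)
Definition bounded_measurable h :=
  measurable_fun [set: T] h /\ exists M, forall x, `|h x| <= M.

Definition expect h : R := \int[P]_x h x.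

Lemma bmf_cst r : bounded_measurable (fun=> r).
Proof. by split; [exact: measurable_cst | exists `|r|]. Qed.

Lemma bmfD f g : bounded_measurable f -> bounded_measurable g ->
  bounded_measurable (fun x => f x + g x).
Proof.
move=> [mf [A hA]] [mg [B hB]]; split; first exact: measurable_funD.
by exists (A + B) => x; rewrite (le_trans (ler_normD _ _)) ?lerD.
Qed.

Lemma bmfM f g : bounded_measurable f -> bounded_measurable g ->
  bounded_measurable (fun x => f x * g x).
Proof.
move=> [mf [A hA]] [mg [B hB]]; split; first exact: measurable_funM.
by exists (A * B) => x; rewrite normrM ler_pM.
Qed.

Lemma bmfN f : bounded_measurable f -> bounded_measurable (fun x => - f x).
Proof.
move=> [mf [A hA]]; split; first exact: measurableT_comp.
by exists A => x; rewrite normrN.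
Qed.

Lemma bmfB f g : bounded_measurable f -> bounded_measurable g ->
  bounded_measurable (fun x => f x - g x).
Proof. by move=> bf /bmfN; exact: bmfD. Qed.

Lemma bmf_sqr f : bounded_measurable f -> bounded_measurable (fun x => f x ^+ 2).
Proof. by move=> bf; exact: bmfM. Qed.

Lemma bmf_norm f : bounded_measurable f -> bounded_measurable (fun x => `|f x|).
Proof.
move=> [mf [A hA]]; split; first exact: measurableT_comp.
by exists A => x; rewrite normr_id.
Qed.

Lemma bmf_expR f : bounded_measurable f ->
  bounded_measurable (fun x => expR (f x)).
Proof.
move=> [mf [A hA]]; split; first exact: measurableT_comp.
exists (expR A) => x; rewrite ger0_norm ?expR_ge0 // ler_expR.
exact: le_trans (ler_norm _) (hA x).
Qed.

Lemma bmf_cosh f : bounded_measurable f -> bounded_measurable (fun x => cosh (f x)).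
Proof.
move=> bf; apply: bmfM (bmf_cst _).
by apply: bmfD; apply: bmf_expR => //; exact: bmfN.
Qed.

Lemma bmf_sinh f : bounded_measurable f -> bounded_measurable (fun x => sinh (f x)).
Proof.
move=> bf; apply: bmfM (bmf_cst _).
by apply: bmfB; apply: bmf_expR => //; exact: bmfN.
Qed.

Lemma bmf_sum (I : Type) (s : seq I) (F : I -> T -> R) :
  (forall i, bounded_measurable (F i)) ->
  bounded_measurable (fun x => \sum_(i <- s) F i x).
Proof.
move=> bF; elim: s => [|i s IH].
  by under eq_fun do rewrite big_nil; exact: bmf_cst.
by under eq_fun do rewrite big_cons; exact: bmfD.
Qed.

Lemma bmf_integrable f : bounded_measurable f -> P.-integrable setT (EFin \o f).
Proof.
move=> [mf [A hA]]; apply: measurable_bounded_integrable => //.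
  by rewrite (le_lt_trans (probability_le1 P _)) ?ltry.
by exists A; split; [exact: num_real | move=> y yA x _; exact: le_trans (hA x) (ltW yA)].
Qed.

Lemma expect_cst r : expect (fun=> r) = r.
Proof. by rewrite /expect Rintegral_cst // [X in fine X](probability_setT P) mulr1. Qed.

Lemma expectD f g : bounded_measurable f -> bounded_measurable g ->
  expect (fun x => f x + g x) = expect f + expect g.
Proof. by move=> bf bg; rewrite /expect RintegralD //; exact: bmf_integrable. Qed.

Lemma expectB f g : bounded_measurable f -> bounded_measurable g ->
  expect (fun x => f x - g x) = expect f - expect g.
Proof. by move=> bf bg; rewrite /expect RintegralB //; exact: bmf_integrable. Qed.

Lemma expectZ r f : bounded_measurable f ->
  expect (fun x => r * f x) = r * expect f.
Proof. by move=> bf; rewrite /expect RintegralZl //; exact: bmf_integrable. Qed.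

Lemma expect_le f g : bounded_measurable f -> bounded_measurable g ->
  (forall x, f x <= g x) -> expect f <= expect g.
Proof.
by move=> bf bg fg; apply: le_Rintegral => //; exact: bmf_integrable.
Qed.

Lemma expect_ge0 f : (forall x, 0 <= f x) -> 0 <= expect f.
Proof. by move=> f0; exact: Rintegral_ge0. Qed.

Lemma expect_sum (I : Type) (s : seq I) (F : I -> T -> R) :
  (forall i, bounded_measurable (F i)) ->
  expect (fun x => \sum_(i <- s) F i x) = \sum_(i <- s) expect (F i).
Proof.
move=> bF; elim: s => [|i s IH].
  by under eq_fun do rewrite big_nil; rewrite expect_cst big_nil.
under eq_fun do rewrite big_cons.
by rewrite expectD // ?big_cons ?IH //; exact: bmf_sum.
Qed.

End BoundedFunctions.

Ltac bmf := repeat first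
  [ assumption | exact: bmf_cst | apply: bmf_cosh | apply: bmf_sinh
  | apply: bmf_sqr | apply: bmf_norm | apply: bmfB | apply: bmfD | apply: bmfM
  | apply: bmfN ].

(** * Smoothness and duality for the entropic potential *)

Section Potential.
Context d (T : measurableType d) (R : realType) (P : probability T R).
Variable (L : R).
Hypothesis L0 : 0 < L.
Notation E := (expect P).
Notation bm := (@bounded_measurable d T R).
Implicit Types (th e f : T -> R).

(* A complex function is the pair (real part, imaginary part). *)
Definition potential th1 th2 : R :=
  1 + L ^+ 2 * (E (fun x => cosh (th1 x) - 1) + E (fun x => cosh (th2 x) - 1)).

(** The derivative of [ln (potential th1 th2)] in the direction [(e1, e2)]. *)
Definition potential_grad th1 th2 e1 e2 : R :=
  L ^+ 2 * (E (fun x => sinh (th1 x) * e1 x) + E (fun x => sinh (th2 x) * e2 x))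
  / potential th1 th2.

Lemma potential_ge1 th1 th2 : 1 <= potential th1 th2.
Proof.
rewrite lerDl mulr_ge0 ?sqr_ge0 // addr_ge0 // expect_ge0 // => x;
  by rewrite subr_ge0 cosh_ge1.
Qed.

(** In the quadratic term [cosh] is split as [1 + (cosh - 1)]: the first part keeps the second
    moment of [e], and only the second pays the uniform bound [L ^+ 2]. *)
Lemma expect_coshD_le th e (al : R) : bm th -> bm e -> (forall x, `|e x| <= L) ->
  `|al| * L <= 3^-1 ->
  E (fun x => cosh (th x + al * e x) - 1) <= E (fun x => cosh (th x) - 1)
    + al * E (fun x => sinh (th x) * e x)
    + al ^+ 2 * (E (fun x => e x ^+ 2) + L ^+ 2 * E (fun x => cosh (th x) - 1)).
Proof.
move=> bth be eL aL.
rewrite -!expectZ -?expectD -?expectZ -?expectD; try by bmf.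
apply: expect_le; try by bmf.
move=> x.
have := @coshD_le _ (th x) (al * e x).
rewrite normrM (le_trans _ aL) ?ler_wpM2l // => /(_ isT) h.
have ch := cosh_ge1 (th x).
have h2 : (cosh (th x) - 1) * e x ^+ 2 <= (cosh (th x) - 1) * L ^+ 2.
  rewrite ler_wpM2l ?subr_ge0 // -[e x ^+ 2]real_normK ?num_real //.
  by rewrite ler_sqr ?nnegrE // ltW.
have := ler_wpM2l (sqr_ge0 al) h2; move: h.
have -> : cosh (th x) * (al * e x) ^+ 2 =
   al ^+ 2 * e x ^+ 2 + al ^+ 2 * ((cosh (th x) - 1) * e x ^+ 2) by ring.
lra.
Qed.

(** The weight [L ^+ 2] in the potential is made for this: the second-order terms add up to at most
    [al ^+ 2 * L ^+ 2] times the potential itself, and [ln q - ln p <= q / p - 1] removes the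
    potential. *)
Lemma ln_potential_step th1 th2 e1 e2 (al : R) :
  bm th1 -> bm th2 -> bm e1 -> bm e2 ->
  (forall x, `|e1 x| <= L) -> (forall x, `|e2 x| <= L) ->
  E (fun x => e1 x ^+ 2) + E (fun x => e2 x ^+ 2) <= 1 ->
  `|al| * L <= 3^-1 ->
  ln (potential (fun x => th1 x + al * e1 x) (fun x => th2 x + al * e2 x)) <=
  ln (potential th1 th2) + al * potential_grad th1 th2 e1 e2 + al ^+ 2 * L ^+ 2.
Proof.
move=> bt1 bt2 be1 be2 eL1 eL2 e12 aL.
have h1 := expect_coshD_le bt1 be1 eL1 aL.
have h2 := expect_coshD_le bt2 be2 eL2 aL.
have L2 : 0 <= L ^+ 2 by exact: sqr_ge0.
have := ler_wpM2l (mulr_ge0 L2 (sqr_ge0 al)) e12.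
move: (ler_wpM2l L2 (lerD h1 h2)).
have := potential_ge1 (fun x => th1 x + al * e1 x) (fun x => th2 x + al * e2 x).
have := potential_ge1 th1 th2.
rewrite /potential_grad /potential.
move: (E (fun x => cosh (th1 x) - 1)) (E (fun x => cosh (th2 x) - 1)).
move: (E (fun x => cosh (th1 x + _) - 1)) (E (fun x => cosh (th2 x + _) - 1)).
move: (E _) (E _) (E _) (E _) => v2 s2 v1 s1 c1' c2' c1 c2 {h1 h2 e12}.
set p := 1 + L ^+ 2 * (c1 + c2); set q := 1 + _ => p1 q1 h h'.
have p0 := lt_le_trans ltr01 p1; have q0 := lt_le_trans ltr01 q1.
have := ln_leB1 (divr_gt0 q0 p0); rewrite ln_div ?posrE // => lnpq.
have : q / p <= 1 + al * (L ^+ 2 * (s1 + s2) / p) + al ^+ 2 * L ^+ 2.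
  rewrite ler_pdivrMr // !mulrDl mul1r -!mulrA mulVf ?gt_eqF // mulr1.
  rewrite /q; move: h h'; rewrite /p. lra.
lra.
Qed.

(** The pointwise inequality is integrated with [b = L ^+ 2], [c = 1 + s] and [w = 1 / (2 p)], [p]
    being the value of the potential. The entropy and [cosh] terms contribute at most 1 each, which
    cancels the [- 2]. *)
Lemma pairing_le_ln_potential f1 f2 th1 th2 (s : R) :
  bm f1 -> bm f2 -> bm th1 -> bm th2 -> 0 <= s ->
  E (fun x => `|f1 x|) + E (fun x => `|f2 x|) = 1 ->
  E (fun x => f1 x ^+ 2) + E (fun x => f2 x ^+ 2) <= L ^+ 2 * s ->
  E (fun x => f1 x * th1 x) + E (fun x => f2 x * th2 x) <=
  ln (potential th1 th2) + ln 2 + ln (1 + s).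
Proof.
move=> bf1 bf2 bt1 bt2 s0 f1n f2n.
have p1 := potential_ge1 th1 th2.
have L2 : 0 < L ^+ 2 by rewrite exprn_gt0.
set p := potential th1 th2 in p1 *.
have p0 : 0 < p by lra.
have w0 : 0 < (2 * p)^-1 by rewrite invr_gt0 mulr_gt0.
have c0 : 0 < 1 + s by lra.
have key f th : bm f -> bm th ->
  E (fun x => f x * th x) <= E (fun x => `|f x|) * (ln (2 * p) + ln (1 + s) - 2)
   + (E (fun x => `|f x|) + E (fun x => f x ^+ 2) / L ^+ 2) / (1 + s)
   + p^-1 * (E (fun x => `|f x|) + L ^+ 2 * E (fun x => cosh (th x) - 1)).
  move=> bf bth.
  rewrite ![E _ * _]mulrC ![(_ + _) / _]mulrC.
  rewrite -?expectZ -?expectD -?expectZ -?expectD; try by bmf.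
  apply: expect_le; try by bmf.
  move=> x; apply: (le_trans (mul_le_cosh_entropy (f x) (th x) L2 w0 c0)).
  rewrite lnV ?posrE ?mulr_gt0 // opprK.
  have -> : 2 * (2 * p)^-1 = p^-1 by field; rewrite gt_eqF.
  rewrite le_eqVlt; apply/orP; left; apply/eqP; field; rewrite ?gt_eqF //.
have := lerD (key _ _ bf1 bt1) (key _ _ bf2 bt2).
rewrite lnM ?posrE //.
set a1 := E (fun x => `|f1 x|) in f1n *; set a2 := E (fun x => `|f2 x|) in f1n *.
set b1 := E (fun x => f1 x ^+ 2) in f2n *; set b2 := E (fun x => f2 x ^+ 2) in f2n *.
set g1 := E (fun x => cosh _ - 1); set g2 := E (fun x => cosh _ - 1).
have pE : p = 1 + L ^+ 2 * (g1 + g2) by [].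
have k1 : (a1 + b1 / L ^+ 2) / (1 + s) + (a2 + b2 / L ^+ 2) / (1 + s) <= 1.
  rewrite -mulrDl ler_pdivrMr // mul1r addrACA f1n lerD2l -mulrDl.
  by rewrite ler_pdivrMr // mulrC.
have k2 : p^-1 * (a1 + L ^+ 2 * g1) + p^-1 * (a2 + L ^+ 2 * g2) = 1.
  rewrite -mulrDr addrACA f1n -mulrDr -pE mulVf ?gt_eqF //.
have k3 : forall z, a1 * z + a2 * z = z by move=> z; rewrite -mulrDl f1n mul1r.
have := k3 (ln 2 + ln p + ln (1 + s) - 2).
lra.
Qed.

End Potential.

(** * Mirror descent *)

Section MirrorDescent.
Context d (T : measurableType d) (R : realType) (P : probability T R).
Variables (n m : nat) (L : R) (p q : 'I_n -> T -> R).
Hypotheses (L0 : 0 < L) (bp : forall i, bounded_measurable (p i))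
  (bq : forall i, bounded_measurable (q i))
  (pqL : forall i x, p i x ^+ 2 + q i x ^+ 2 <= L ^+ 2)
  (pq1 : forall i, expect P (fun x => p i x ^+ 2) + expect P (fun x => q i x ^+ 2) = 1).
Notation E := (expect P).

(* A letter (i, c, b, j) stands for the step of length 2 ^ - j / (4 L) along
   phi_i or i phi_i (according to c), with sign (- 1) ^ b. *)
Definition letter := ('I_n * bool * bool * 'I_m)%type.

Definition dir1 (i : 'I_n) (c : bool) : T -> R := if c then (fun x => - q i x) else p i.
Definition dir2 (i : 'I_n) (c : bool) : T -> R := if c then p i else q i.
Definition step_size (b : bool) (j : nat) : R := (-1) ^+ b * (2 ^- j / (4 * L)).

(** The head of the list is the latest step. An iterate depends on its letters alone and not on the
    target, which makes the iterates countable in a union bound. *)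
Fixpoint state1 (s : seq letter) : T -> R :=
  if s is (i, c, b, j) :: s' then fun x => state1 s' x + step_size b j * dir1 i c x
  else fun=> 0.
Fixpoint state2 (s : seq letter) : T -> R :=
  if s is (i, c, b, j) :: s' then fun x => state2 s' x + step_size b j * dir2 i c x
  else fun=> 0.

Definition state_coef (s : seq letter) (i : 'I_n) (c : bool) : R :=
  potential_grad P L (state1 s) (state2 s) (dir1 i c) (dir2 i c).

(** The real part of the Hermitian product of [f1 + i f2] and [e1 + i e2]; against i phi_i it
    returns the imaginary part of the product with phi_i. *)
Definition real_pairing (f1 f2 e1 e2 : T -> R) : R :=
  E (fun x => f1 x * e1 x) + E (fun x => f2 x * e2 x).

Lemma bmf_dir1 i c : bounded_measurable (dir1 i c).
Proof. by rewrite /dir1; case: c; [exact: bmfN | exact: bp]. Qed.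

Lemma bmf_dir2 i c : bounded_measurable (dir2 i c).
Proof. by rewrite /dir2; case: c. Qed.

Lemma bmf_state1 s : bounded_measurable (state1 s).
Proof.
elim: s => [|[[[i c] b] j] s IH] /=; first exact: bmf_cst.
apply: bmfD => //; apply: bmfM; [exact: bmf_cst | exact: bmf_dir1].
Qed.

Lemma bmf_state2 s : bounded_measurable (state2 s).
Proof.
elim: s => [|[[[i c] b] j] s IH] /=; first exact: bmf_cst.
apply: bmfD => //; apply: bmfM; [exact: bmf_cst | exact: bmf_dir2].
Qed.

Lemma coordinate_le i x : `|p i x| <= L /\ `|q i x| <= L.
Proof.
have h := pqL i x; have p2 := sqr_ge0 (p i x); have q2 := sqr_ge0 (q i x).
by split; rewrite -ler_sqr ?nnegrE ?(ltW L0) // real_normK ?num_real //; lra.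
Qed.

Lemma dir1_le i c x : `|dir1 i c x| <= L.
Proof. by rewrite /dir1; case: c; rewrite ?normrN; case: (coordinate_le i x). Qed.

Lemma dir2_le i c x : `|dir2 i c x| <= L.
Proof. by rewrite /dir2; case: c; case: (coordinate_le i x). Qed.

Lemma dir_norm i c :
  E (fun x => dir1 i c x ^+ 2) + E (fun x => dir2 i c x ^+ 2) <= 1.
Proof.
rewrite /dir1 /dir2; case: c; last by rewrite pq1.
by under eq_fun do rewrite sqrrN; rewrite addrC pq1.
Qed.

Lemma step_size_le b j : `|step_size b j| * L <= 3^-1.
Proof.
have h : (2 ^- j : R) <= 1 by rewrite invf_le1 ?exprn_gt0 // exprn_ege1 // ler1n.
have h0 : 0 <= (2 ^- j : R) by rewrite invr_ge0 exprn_ge0.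
rewrite /step_size normrM normr_sign mul1r ger0_norm; last first.
  by rewrite divr_ge0 // mulr_ge0 // ltW.
have -> : 2 ^- j / (4 * L) * L = 2 ^- j / 4 by field; rewrite !gt_eqF ?exprn_gt0 //.
lra.
Qed.

Section Target.
Variables (f1 f2 : T -> R).
Hypotheses (bf1 : bounded_measurable f1) (bf2 : bounded_measurable f2).

(** The objective of the descent. Its derivative along a direction is the coefficient of the state
    minus that of the target. *)
Definition dual_gap (s : seq letter) : R :=
  ln (potential P L (state1 s) (state2 s)) - real_pairing f1 f2 (state1 s) (state2 s).

Lemma dual_gap_nil : dual_gap [::] = 0.
Proof.
rewrite /dual_gap /real_pairing /potential /=.
have z f : E (fun x => f x * 0) = 0.
  by under eq_fun do rewrite mulr0; exact: expect_cst.
by rewrite !z cosh0 subrr expect_cst !addr0 mulr0 addr0 ln1 subr0.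
Qed.

Lemma real_pairing_cons i c b (j : 'I_m) s :
  let s' := ((i, c, b, j) : letter) :: s in
  real_pairing f1 f2 (state1 s') (state2 s') =
  real_pairing f1 f2 (state1 s) (state2 s) +
  step_size b j * real_pairing f1 f2 (dir1 i c) (dir2 i c).
Proof.
have bs1 := bmf_state1 s; have bs2 := bmf_state2 s.
have bd1 := bmf_dir1 i c; have bd2 := bmf_dir2 i c.
rewrite /real_pairing /= mulrDr -!expectZ; try by bmf.
rewrite [RHS]addrACA; congr (_ + _); rewrite -expectD; try by bmf.
  by congr expect; apply/funext => x; ring.
by congr expect; apply/funext => x; ring.
Qed.

(** The sign of the step is that of the residual [r - g]. The linear gain [al * (r - g)] exceeds
    [4 ^- j / 4], the curvature costs [4 ^- j / 16], and at least [4 ^- j / 8] remains. *)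
Lemma dual_gap_step s i c (j : 'I_m) :
  L * 2 ^- j < `|real_pairing f1 f2 (dir1 i c) (dir2 i c) - state_coef s i c| ->
  exists b, dual_gap (((i, c, b, j) : letter) :: s) <= dual_gap s - 4 ^- j / 8.
Proof.
set r := real_pairing _ _ _ _; set g := state_coef _ _ _ => rg.
exists (r - g < 0); rewrite /dual_gap real_pairing_cons -/r /=.
set al := step_size _ _.
have h := @ln_potential_step _ _ _ P L L0 _ _ _ _ al (bmf_state1 s) (bmf_state2 s)
  (bmf_dir1 i c) (bmf_dir2 i c) (dir1_le i c) (dir2_le i c) (dir_norm i c)
  (step_size_le _ _).
rewrite -/(state_coef s i c) -/g in h.
have t0 : 0 < (2 ^- j : R) by rewrite invr_gt0 exprn_gt0.
have e1 : al * (r - g) = 2 ^- j / (4 * L) * `|r - g|.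
  by rewrite (normrEsign (r - g)) /al /step_size [RHS]mulrCA mulrA.
have e2 : al ^+ 2 * L ^+ 2 = (2 ^- j) ^+ 2 / 16.
  rewrite /al /step_size exprMn sqrr_sign mul1r; field; rewrite !gt_eqF ?exprn_gt0 //.
have e3 : (4 ^- j : R) = (2 ^- j) ^+ 2.
  by rewrite (_ : 4 = 2 ^+ 2) ?exprVn -?exprM 1?mulnC //; ring.
have : (2 ^- j) ^+ 2 / 4 <= al * (r - g).
  rewrite e1 (_ : _ / 4 = 2 ^- j / (4 * L) * (L * 2 ^- j)); last first.
    by field; rewrite !gt_eqF ?exprn_gt0 //.
  by rewrite ler_wpM2l ?(ltW rg) // divr_ge0 ?mulr_ge0 // ltW.
rewrite e2 in h; rewrite e3; have := sqr_ge0 (2 ^- j : R).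
move: h; rewrite mulrBr.
move: (ln _) (ln _) (real_pairing _ _ _ _) (al * r) (al * g) ((2 ^- j) ^+ 2) => *.
lra.
Qed.

End Target.

(** The order of quantifiers matters: [w] is fixed before the target, so one random choice can serve
    every target. When no residual exceeds [L * 2 ^- j], a reverse triangle inequality for each of
    the two directions at [i] gives the factor 2. *)
Lemma greedy_descent :
  exists w : seq letter -> 'I_n -> R, forall f1 f2 : T -> R, forall s2 : R,
  bounded_measurable f1 -> bounded_measurable f2 -> 0 <= s2 ->
  E (fun x => `|f1 x|) + E (fun x => `|f2 x|) = 1 ->
  E (fun x => f1 x ^+ 2) + E (fun x => f2 x ^+ 2) <= L ^+ 2 * s2 ->
  exists V : seq letter -> R,
  [/\ V [::] = 0, forall s, - (ln 2 + ln (1 + s2)) <= V s &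
      forall s (j : 'I_m), (exists x, V (x :: s) <= V s - 4 ^- j / 8) \/
        forall i, `| `|real_pairing f1 f2 (p i) (q i)|
                     + `|real_pairing f1 f2 (fun x => - q i x) (p i)| - w s i|
                  <= 2 * (L * 2 ^- j)].
Proof.
exists (fun s i => `|state_coef s i false| + `|state_coef s i true|).
move=> f1 f2 s2 bf1 bf2 s20 fn1 fn2.
exists (dual_gap f1 f2); split; first exact: dual_gap_nil.
  move=> s; rewrite /dual_gap.
  have := pairing_le_ln_potential L0 bf1 bf2 (bmf_state1 s) (bmf_state2 s) s20 fn1 fn2.
  rewrite -/(real_pairing _ _ _ _).
  move: (ln _) (ln _) (ln _) (real_pairing _ _ _ _) => *; lra.
move=> s j.
have [[i [c h]]|h] := pselect (exists i c,
  L * 2 ^- j < `|real_pairing f1 f2 (dir1 i c) (dir2 i c) - state_coef s i c|).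
  by left; have [b hb] := dual_gap_step bf1 bf2 h; eexists; exact: hb.
right=> i.
have hc c : `|real_pairing f1 f2 (dir1 i c) (dir2 i c) - state_coef s i c| <= L * 2 ^- j.
  by rewrite leNgt; apply/negP => hlt; apply: h; exists i, c.
have := hc true; have := hc false; rewrite /dir1 /dir2.
move: (state_coef s i false) (state_coef s i true).
move: (real_pairing _ _ _ _) (real_pairing _ _ _ _) => a b a' b' ha hb.
rewrite opprD addrACA (le_trans (ler_normD _ _)) // (_ : 2 = 1 + 1) // mulrDl mul1r.
by rewrite lerD // (le_trans (ler_dist_dist _ _)).
Qed.

End MirrorDescent.

(** * From the descent to a bound on the coefficients *)

Section Rearrangement.
Context {R : realType} (n : nat) (u : 'I_n -> R).
Hypothesis u0 : forall i, 0 <= u i.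

Definition decreasing_rearrangement (k : nat) : R :=
  nth 0 (sort >=%R [seq u i | i <- enum 'I_n]) k.
Local Notation v := decreasing_rearrangement.
Local Notation us := (sort >=%R [seq u i | i <- enum 'I_n]).

Let size_us : size us = n.
Proof. by rewrite size_sort size_map size_enum_ord. Qed.

Let ge_trans : transitive (>=%R : rel R).
Proof. by move=> y x z /= h1 h2; exact: le_trans h2 h1. Qed.

Let ge_total : total (>=%R : rel R).
Proof. by move=> x y /=; exact: le_total. Qed.

Lemma rearrangement_ge0 k : 0 <= v k.
Proof.
rewrite /v; have [kn|kn] := ltnP k (size us); last by rewrite nth_default.
have := mem_nth 0 kn; rewrite mem_sort => /mapP[i _ ->]; exact: u0.
Qed.

Lemma rearrangement_default k : (n <= k)%N -> v k = 0.
Proof. by move=> nk; rewrite /v nth_default // size_us. Qed.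

Lemma rearrangement_mono k l : (k <= l)%N -> v l <= v k.
Proof.
move=> kl; have [ln|nl] := ltnP l n; last by rewrite (rearrangement_default nl) rearrangement_ge0.
apply: (sorted_leq_nth ge_trans) => //; rewrite ?inE ?size_us //.
- by move=> x /=.
- exact: sort_sorted.
- exact: leq_ltn_trans kl ln.
Qed.

Lemma rearrangement_le b k : 0 <= b -> (forall i, u i <= b) -> v k <= b.
Proof.
move=> b0 ub; rewrite /v; have [kn|kn] := ltnP k (size us); last by rewrite nth_default.
have := mem_nth 0 kn; rewrite mem_sort => /mapP[i _ ->]; exact: ub.
Qed.

Lemma sum_rearrangement (F : R -> R) : \sum_(k < n) F (v k) = \sum_i F (u i).
Proof.
rewrite -(big_mkord xpredT (fun k => F (v k))).
transitivity (\sum_(y <- us) F y).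
  by rewrite [RHS](big_nth 0) size_us.
by rewrite (perm_big _ (permEl (perm_sort _ _))) /= big_map big_enum.
Qed.

(** Ranks start at 0, so the first [k.+1] sorted values are all at least [v k]; hence the strict
    inequality. *)
Lemma card_ge_rearrangement k : (k < n)%N -> (k < #|[set i | (v k <= u i)%R]%SET|)%N.
Proof.
move=> kn.
have -> : #|[set i | (v k <= u i)%R]%SET| = count (fun y => v k <= y) us.
  rewrite (permP (permEl (perm_sort _ _))) count_map cardE size_filter -enumT.
  by apply: eq_count => i; rewrite !inE.
rewrite -(cat_take_drop k.+1 us) count_cat.
apply: leq_trans (leq_addr _ _).
have : all (fun y => v k <= y) (take k.+1 us).
  apply/(all_nthP 0) => l; rewrite size_takel ?size_us // ltnS => lk.
  by rewrite nth_take ?ltnS //; exact: rearrangement_mono.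
rewrite all_count => /eqP ->.
by rewrite size_takel ?size_us.
Qed.

(** The sorted values are cut into blocks of length [M], each dominated by its first entry; [n]
    blocks cover everything since [n <= M * n]. *)
Lemma sum_sqr_rearrangement_blocks (M : nat) : (0 < M)%N ->
  \sum_i u i ^+ 2 <= M%:R * \sum_(t < n) v (M * t) ^+ 2.
Proof.
move=> M0; rewrite -(sum_rearrangement (fun y => y ^+ 2)).
have blocks N : \sum_(k < M * N) v k ^+ 2 <= M%:R * \sum_(t < N) v (M * t) ^+ 2.
  elim: N => [|N IH]; first by rewrite muln0 !big_ord0 mulr0.
  rewrite mulnS addnC big_split_ord /= big_ord_recr /= mulrDr lerD //.
  have -> : M%:R * v (M * N) ^+ 2 = \sum_(i < M) v (M * N) ^+ 2.
    by rewrite sumr_const card_ord mulr_natl.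
  apply: ler_sum => i _; rewrite ler_sqr ?nnegrE ?rearrangement_ge0 //.
  by rewrite rearrangement_mono ?leq_addr.
apply: le_trans (blocks n).
rewrite -(big_mkord xpredT (fun k => v k ^+ 2)) -(big_mkord xpredT (fun k => v k ^+ 2)).
rewrite (@big_cat_nat _ _ _ n 0 (M * n)) //= ?leq_pmull // lerDl.
by apply: sumr_ge0 => k _; exact: sqr_ge0.
Qed.

End Rearrangement.

(** * Total gain of the descent for a target vanishing on a hitting set *)

Section DescentBound.
Context {R : realType} (n M : nat) (L D : R) (X : Type).
Variables (u : 'I_n -> R) (w : seq X -> 'I_n -> R) (V : seq X -> R) (J : {set 'I_n}).
Hypotheses (L0 : 0 < L) (M0 : (0 < M)%N) (n0 : (0 < n)%N)
  (u0 : forall i, 0 <= u i) (uL : forall i, u i <= 2 * L)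
  (uJ : forall i, i \in J -> u i = 0).
Hypothesis J_hits : forall (s : seq X) (j : 'I_n.+4), (size s < n)%N ->
  (M * (size s).+1 <= #|[set i | (2 * (L * 2 ^- j) < w s i)%R]%SET|)%N ->
  exists2 i, i \in J & 2 * (L * 2 ^- j) < w s i.
Hypotheses (V0 : V [::] = 0) (VD : forall s, - D <= V s).
Hypothesis V_step : forall s (j : 'I_n.+4),
  (exists x, V (x :: s) <= V s - 4 ^- j / 8) \/
  forall i, `|u i - w s i| <= 2 * (L * 2 ^- j).

Local Notation v := (decreasing_rearrangement u).
Local Notation tau j := (L * 2 ^- j).

(** The least [j] with [4 * tau j < v k] works: by minimality [v k] is at most 4 times the preceding
    level, that is [8 * tau j]. The case [j = 0] is excluded by [v k <= 2 * L], and the assumption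
    makes level [n.+3] admissible. *)
Lemma dyadic_level k : 8 * tau n.+3 < v k ->
  exists j : 'I_n.+4, 4 * tau j < v k <= 8 * tau j.
Proof.
move=> hk.
have tau_gt0 j : 0 < tau j by rewrite mulr_gt0 // invr_gt0 exprn_gt0.
have ex : exists j, 4 * tau j < v k.
  by exists n.+3; apply: lt_trans hk; rewrite ltr_pM2r ?tau_gt0 ?ltr_nat.
have jn : (ex_minn ex < n.+4)%N.
  case: ex_minnP => j _; rewrite ltnS; apply.
  by apply: lt_trans hk; rewrite ltr_pM2r ?tau_gt0 ?ltr_nat.
exists (Ordinal jn) => /=; case: ex_minnP => [[|j]] h1 h2.
  have := rearrangement_le k (_ : 0 <= 2 * L) uL.
  rewrite ltW ?mulr_gt0 // => /(_ isT) /(lt_le_trans h1).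
  by rewrite expr0 invr1 mulr1 ltr_pM2r // ltr_nat.
rewrite h1 /= leNgt; apply/negP => h3.
suff /h2 : 4 * tau j < v k by rewrite ltnn.
by move: h3; rewrite exprS invfM; have := tau_gt0 j; lra.
Qed.

(** Induction on [t]. Either [v (M * t.+1)] is at most [8 * tau n.+3], and no letter is added
    because the new summand is nonpositive, or a letter at the dyadic level of [v (M * t.+1)] pays
    for it. *)
Lemma greedy_run t : (t < n)%N -> exists s, (size s <= t)%N /\
  V s <= - (\sum_(1 <= r < t.+1) (v (M * r) ^+ 2 - 64 * tau n.+3 ^+ 2)) / (512 * L ^+ 2).
Proof.
have L2 : 0 < 512 * L ^+ 2 by apply: mulr_gt0; [rewrite ltr0n | exact: exprn_gt0].
elim: t => [|t IH] tn.
  by exists [::]; rewrite leqnn (big_geq (leqnn _)) oppr0 mul0r V0 lexx.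
have [s [st hs]] := IH (ltnW tn).
have [small|large] := lerP (v (M * t.+1)) (8 * tau n.+3).
  exists s; split; first exact: leqW.
  apply: (le_trans hs); rewrite ler_pM2r ?invr_gt0 // lerN2.
  rewrite [leLHS]big_nat_recr //= gerDl subr_le0.
  rewrite (_ : 64 * _ = (8 * tau n.+3) ^+ 2); last by rewrite [RHS]exprMn; congr (_ * _); ring.
  by rewrite ler_sqr ?nnegrE ?rearrangement_ge0 // (le_trans _ small) ?rearrangement_ge0.
have [j /andP[j1 j2]] := dyadic_level large.
have tau_gt0 : 0 < tau j by rewrite mulr_gt0 // invr_gt0 exprn_gt0.
have [[x hx]|close] := V_step s j.
  exists (x :: s); split => //; apply: (le_trans hx).
  rewrite big_nat_recr //= opprD mulrDl lerD // mulNr lerN2.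
  rewrite ler_pdivrMr // lerBlDr (@le_trans _ _ ((8 * tau j) ^+ 2)) //.
    by rewrite ler_sqr ?nnegrE ?rearrangement_ge0 // mulr_ge0 // ltW.
  (* Here 512 is 8 times 64: the gain [4 ^- j / 8] is [(8 * tau j) ^+ 2 / (512 * L ^+ 2)]. *)
  rewrite (_ : 4 ^- j / 8 * (512 * L ^+ 2) = (8 * tau j) ^+ 2).
    by rewrite lerDl mulr_ge0 // sqr_ge0.
  rewrite (_ : 4 = 2 ^+ 2) -?exprM 1?mulnC ?exprM; try by ring.
  by field; rewrite expf_neq0.
(* The remaining case is contradictory. More than [M * t.+1] indices have [u i > 4 * tau j], hence
   [w s i > 2 * tau j]; so [J] contains an index with [w s i > 2 * tau j] although [u i = 0]. *)
have kn : (M * t.+1 < n)%N.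
  rewrite ltnNge; apply/negP => /(rearrangement_default u) e.
  by move: j1; rewrite e; lra.
have [||i iJ wi] := J_hits (s := s) (j := j); first exact: leq_ltn_trans st (ltnW tn).
  apply: (@leq_trans (M * t.+1)); first by rewrite leq_mul2l ltnS st orbT.
  apply: (leq_trans (ltnW (card_ge_rearrangement u0 kn))).
  apply: subset_leq_card; apply/fintype.subsetP => i; rewrite !inE => vi.
  by have := close i; rewrite ler_norml => /andP[_]; move: vi j1; lra.
by have := close i; rewrite uJ // ler_norml => /andP[]; move: wi; lra.
Qed.

(** The block of rank 0 gives at most [4 * L ^+ 2]. The skipped levels cost at most [L ^+ 2], since
    64 times [4 ^- n.+3] is [4 ^- n]; this is why there are [n.+4] levels. Together they make the
    5. *)
Lemma sum_sqr_le_descent :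
  \sum_i u i ^+ 2 <= M%:R * (L ^+ 2 * (5 + 512 * D)).
Proof.
apply: (le_trans (sum_sqr_rearrangement_blocks u0 M0)).
rewrite ler_pM2l ?ltr0n //.
have L2 : 0 < L ^+ 2 by rewrite exprn_gt0.
have n1 : (n.-1 < n)%N by rewrite prednK.
have [s [_]] := greedy_run n1; rewrite prednK // mulNr lerNr => hs.
have {hs} := le_trans hs (_ : - V s <= D); rewrite lerNl VD => /(_ isT).
rewrite ler_pdivrMr; last by apply: mulr_gt0; [rewrite ltr0n | exact: L2].
rewrite sumrB sumr_const_nat.
have -> : \sum_(t < n) v (M * t) ^+ 2 = v 0 ^+ 2 + \sum_(1 <= r < n) v (M * r) ^+ 2.
  rewrite -(big_mkord xpredT (fun t => v (M * t) ^+ 2)) big_ltn //.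
  by rewrite muln0.
have v0 : v 0 ^+ 2 <= 4 * L ^+ 2.
  have L20 : 0 <= 2 * L by rewrite mulr_ge0 // ltW.
  have -> : 4 * L ^+ 2 = (2 * L) ^+ 2 by ring.
  by rewrite ler_sqr ?nnegrE ?rearrangement_ge0 //; exact: rearrangement_le.
have small : (64 * tau n.+3 ^+ 2) *+ (n - 1) <= L ^+ 2.
  have -> : (64 * tau n.+3 ^+ 2) *+ (n - 1) = L ^+ 2 * ((n - 1)%:R * 4 ^- n).
    rewrite -mulr_natl (_ : 4 = 2 ^+ 2) -?exprM 1?mulnC ?exprM; try by ring.
    by rewrite !exprS; field; rewrite expf_neq0.
  rewrite ger_pMr // ler_pdivrMr ?exprn_gt0 // mul1r.
  rewrite (@le_trans _ _ n%:R) ?ler_nat ?leq_subr // -natrX ler_nat.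
  by rewrite ltnW // ltn_expl.
move: (\sum_(1 <= r < n) _) v0 small => S; lra.
Qed.

End DescentBound.

(** * Hitting sets *)

Section HittingSets.
Local Open Scope nat_scope.
Local Open Scope set_scope.

(** For each length [t] at most [K ^ t.+1] pairs [(s, y)] occur, so their bad sets fill at most a
    fraction 2^-(t+1) of [W], and these fractions sum to less than 1 over [t < n]. *)
Lemma union_bound_seq (W X Y : finType) (n K : nat) (bad : seq X -> Y -> {set W}) :
  0 < #|W| -> 0 < K -> #|X| <= K -> #|Y| <= K ->
  (forall s y, size s < n -> #|bad s y| * (2 * K) ^ (size s).+1 <= #|W|) ->
  exists o : W, forall s y, size s < n -> o \notin bad s y.
Proof.
move=> W0 K0 XK YK hbad.
pose U := \bigcup_(t : 'I_n) \bigcup_(s : t.-tuple X) \bigcup_(y : Y) bad s y.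
suff UW : #|U| < #|W|.
  have /fintype.properP[_ ex] : U \proper [set: W].
    by rewrite properEcard finset.subsetT /= cardsT.
  case: ex => o _ oU; exists o => s y sn; apply: contra oU => os.
  apply/bigcupP; exists (Ordinal sn) => //.
  by apply/bigcupP; exists (in_tuple s) => //; apply/bigcupP; exists y.
pose wt (t : 'I_n) : rat := (2^-1 ^+ t.+1 * #|W|%:R)%R.
have geo N : (\sum_(t < N) (2^-1 : rat) ^+ t.+1 = 1 - 2^-1 ^+ N)%R.
  elim: N => [|N IH]; first by rewrite big_ord0 expr0 subrr.
  by rewrite big_ord_recr /= IH exprS; lra.
rewrite -(ltr_nat rat).
apply: (@le_lt_trans _ _ (\sum_(t < n) wt t)%R); last first.
  rewrite -mulr_suml geo mulrBl mul1r ltrBlDr ltrDl.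
  by rewrite mulr_gt0 ?exprn_gt0 ?ltr0n.
have step1 : #|U| <= \sum_(t < n) \sum_(s : t.-tuple X) \sum_(y : Y) #|bad s y|.
  rewrite /U; elim/big_ind2: _ => [|A a B b hA hB|t _]; first by rewrite cards0.
    by rewrite (leq_trans (leq_card_setU _ _)) // leq_add.
  elim/big_ind2: _ => [|A a B b hA hB|s _]; first by rewrite cards0.
    by rewrite (leq_trans (leq_card_setU _ _)) // leq_add.
  elim/big_ind2: _ => [|A a B b hA hB|//]; first by rewrite cards0.
  by rewrite (leq_trans (leq_card_setU _ _)) // leq_add.
apply: (@le_trans _ _ (\sum_(t < n) \sum_(s : t.-tuple X) \sum_(y : Y) #|bad s y|)%:R%R).
  by rewrite ler_nat.
rewrite natr_sum; apply: ler_sum => t _.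
have K2 : (0 < (2 * K)%:R ^+ t.+1 :> rat)%R by rewrite exprn_gt0 // ltr0n muln_gt0.
rewrite -(ler_pM2r K2) -natrX -natrM.
have -> : (wt t * ((2 * K) ^ t.+1)%:R = (K ^ t.+1 * #|W|)%:R)%R.
  by rewrite /wt expnMn !natrM !natrX exprVn mulrAC mulrA mulVf ?mul1r ?expf_neq0.
rewrite ler_nat big_distrl /=.
apply: (@leq_trans (\sum_(s : t.-tuple X) \sum_(y : Y) #|W|)).
  apply: leq_sum => s _; rewrite big_distrl /=; apply: leq_sum => y _.
  by have := hbad s y; rewrite size_tuple; apply.
rewrite !sum_nat_const card_tuple mulnA leq_mul2r expnSr leq_mul ?orbT //.
by case: (nat_of_ord t) => [|t']; rewrite ?expn0 ?leq_exp2r.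
Qed.

(** [J] is the image of [k] independent uniform draws. All of them miss a given set of at least M (t
    + 1) indices with probability at most exp (- k M (t + 1) / n), which is at most (2 K)^-(t+1) as
    the union bound requires. *)
Lemma random_hitting_set {R : realType} (X Y : finType) (n k K M : nat)
    (A : seq X -> Y -> {set 'I_n}) :
  0 < n -> 0 < K -> #|X| <= K -> #|Y| <= K ->
  (n%:R * ln (2 * K)%:R <= k%:R * M%:R :> R)%R ->
  exists J : {set 'I_n}, #|J| <= k /\
    forall s y, size s < n -> M * (size s).+1 <= #|A s y| ->
      exists2 i, i \in J & i \in A s y.
Proof.
move=> n0 K0 XK YK hM.
pose bad s y : {set {ffun 'I_k -> 'I_n}} :=
  if M * (size s).+1 <= #|A s y| then [set h in ffun_on (mem (~: A s y))] else finset.set0.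
have cW : #|{: {ffun 'I_k -> 'I_n}}| = n ^ k by rewrite card_ffun !card_ord.
have W0 : 0 < #|{: {ffun 'I_k -> 'I_n}}| by rewrite cW expn_gt0 n0.
have [s y sn|h hh] := union_bound_seq (n := n) (bad := bad) W0 K0 XK YK.
  rewrite cW /bad; case: ifP => [hA|_]; last by rewrite cards0.
  rewrite cardsE card_ffun_on card_ord.
  have n0' : (0 < n%:R :> R)%R by rewrite ltr0n.
  rewrite -(ler_nat R) natrM !natrX.
  have -> : (#|~: A s y|%:R = n%:R - #|A s y|%:R :> R)%R.
    by apply/eqP; rewrite eq_sym subr_eq -natrD addnC cardsC card_ord.
  have e1 : (n%:R - #|A s y|%:R <= n%:R * expR (- (#|A s y|%:R / n%:R)) :> R)%R.
    have := @expR_ge1Dx R (- (#|A s y|%:R / n%:R)).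
    rewrite -(ler_pM2l n0') mulrDr mulr1 mulrN mulrCA divff ?mulr1 //.
    by rewrite gt_eqF.
  have e0 : (0 <= n%:R - #|A s y|%:R :> R)%R.
    by rewrite subr_ge0 ler_nat -[leqRHS]card_ord max_card.
  apply: (@le_trans _ _ ((n%:R * expR (- (#|A s y|%:R / n%:R))) ^+ k
                         * (2 * K)%:R ^+ (size s).+1)%R).
    rewrite ler_wpM2r ?exprn_ge0 // lerXn2r ?nnegrE // mulr_ge0 ?expR_ge0 //.
  have K2 : (0 < (2 * K)%:R :> R)%R by rewrite ltr0n muln_gt0.
  have -> : ((2 * K)%:R = expR (ln (2 * K)%:R) :> R)%R by rewrite lnK.
  rewrite exprMn -mulrA ger_pMr ?exprn_gt0 // -!expRM_natl -expRD expR_le1.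
  rewrite mulrN addrC subr_le0 -(ler_pM2l n0').
  have -> : (n%:R * (k%:R * (#|A s y|%:R / n%:R)) = k%:R * #|A s y|%:R :> R)%R.
    by field; rewrite gt_eqF.
  rewrite mulrCA (le_trans (ler_wpM2l _ hM)) // mulrCA ler_wpM2l //.
  by rewrite mulrC -natrM ler_nat.
exists [set h i | i : 'I_k]; split.
  by rewrite (leq_trans (leq_imset_card _ _)) // card_ord.
move=> s y sn hA; have := hh s y sn; rewrite /bad hA inE => /ffun_onP.
move=> hn; have [i /negbTE hi] : exists i, h i \notin ~: A s y.
  apply/existsP; rewrite -negb_forall; apply/negP => /forallP.
  by move=> H; apply: hn => i; exact: H.
by exists (h i); [exact: imset_f | move: hi; rewrite inE => /negbFE].
Qed.

Lemma card_prescribed_ffun (n m : nat) (h : 'I_n -> 'I_m) (g : 'I_n -> bool)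
    (A : {set 'I_n}) :
  #|[set b : {ffun 'I_m -> bool} | [forall i in A, b (h i) == g i]]| * 2 ^ #|h @: A|
  <= 2 ^ m.
Proof.
(* One constraint is kept for each point of [h @: A]. Indices with the same image may prescribe
   conflicting values; dropping all but one only enlarges the set. *)
pose F (j : 'I_m) : pred bool :=
  if [pick i in A | h i == j] is Some i then pred1 (g i) else predT.
apply: (@leq_trans (#|family F| * 2 ^ #|h @: A|)).
  rewrite leq_mul2r subset_leq_card ?orbT //; apply/fintype.subsetP => b.
  rewrite inE => /forallP hb; apply/familyP => j; rewrite /F.
  case: pickP => [i /andP[iA /eqP <-]|//].
  by have := hb i; rewrite iA.
rewrite card_family foldrE big_map big_enum /= (bigID (mem (h @: A))) /=.
rewrite big1 ?mul1n => [|j /imsetP[i iA ->]]; last first.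
  rewrite /F; case: pickP => [i' _|/(_ i)]; first by rewrite card1.
  by rewrite iA eqxx.
apply: (@leq_trans (\prod_(j | j \notin h @: A) 2 * 2 ^ #|h @: A|)).
  rewrite leq_mul2r leq_prod ?orbT // => j _.
  by rewrite (leq_trans (max_card _)) // card_bool.
rewrite prod_nat_const -expnD leq_exp2l //.
have -> : #|[pred j | j \notin h @: A]| = #|~: (h @: A)|.
  by apply: eq_card => j; rewrite !inE.
by rewrite addnC cardsC card_ord.
Qed.

(* One element is kept from each pair {2l, 2l+1}, by independent coin flips. *)
Lemma random_halving (X Y : finType) (n m K M : nat)
    (A : seq X -> Y -> {set 'I_n}) :
  n = m.*2 -> 0 < K -> #|X| <= K -> #|Y| <= K -> 4 * K <= 2 ^ M ->
  exists I : {set 'I_n}, #|I| = m /\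
    forall s y, size s < n -> 2 * M * (size s).+1 <= #|A s y| ->
      (exists2 i, i \in I & i \in A s y) /\ (exists2 i, i \in ~: I & i \in A s y).
Proof.
move=> nE K0 XK YK hM; subst n.
have half_lt (i : 'I_m.*2) : i./2 < m.
  rewrite -ltn_double (leq_ltn_trans _ (ltn_ord i)) //.
  by rewrite -[leqRHS]odd_double_half leq_addl.
pose h (i : 'I_m.*2) := Ordinal (half_lt i).
have h_odd i j : h i = h j -> odd i = odd j -> i = j.
  move=> /(congr1 val) /= hij oij; apply/val_inj => /=.
  by rewrite -[LHS]odd_double_half -[RHS]odd_double_half hij oij.
pose I (b : {ffun 'I_m -> bool}) := [set i : 'I_m.*2 | b (h i) == odd i].
(* [h] is injective on [I b] and on its complement, so each has at most [m] elements, and together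
   they have [m + m]. *)
have cI b : #|I b| = m.
  have inj1 : #|I b| <= m.
    rewrite -[leqRHS]card_ord -(card_in_imset (f := h)) ?max_card //.
    by move=> i j; rewrite !inE => /eqP bi /eqP bj hij; apply: h_odd; rewrite // -bi -bj hij.
  have inj2 : #|~: I b| <= m.
    rewrite -[leqRHS]card_ord -(card_in_imset (f := h)) ?max_card //.
    move=> i j; rewrite !inE => bi bj hij; apply: h_odd => //.
    by move: bi bj; rewrite hij; case: (b _); case: (odd i); case: (odd j).
  have e : #|I b| + #|~: I b| = m + m by rewrite cardsC card_ord addnn.
  by apply/eqP; rewrite eqn_leq inj1 /= -(leq_add2r #|~: I b|) e leq_add2l.
(* The two sets consist of the flips for which [I b], respectively its complement, misses
   [A s y]. *)
pose bad s y : {set {ffun 'I_m -> bool}} := if 2 * M * (size s).+1 <= #|A s y| then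
    [set b : {ffun 'I_m -> bool} | [forall i in A s y, b (h i) == ~~ odd i]] :|:
    [set b : {ffun 'I_m -> bool} | [forall i in A s y, b (h i) == odd i]]
  else finset.set0.
have cW : #|{: {ffun 'I_m -> bool}}| = 2 ^ m by rewrite card_ffun card_bool card_ord.
have W0 : 0 < #|{: {ffun 'I_m -> bool}}| by rewrite cW expn_gt0.
have [s y sn|b hb] := union_bound_seq (n := m.*2) (bad := bad) W0 K0 XK YK.
  rewrite cW /bad; case: ifP => [hA|_]; last by rewrite cards0.
  set B1 := [set b | _]; set B2 := [set b | _].
  (* A pair holds at most two indices, so at least half as many coins as indices are involved. *)
  have hA2 : #|A s y| <= 2 * #|h @: A s y|.
    rewrite -(@card_in_imset _ _ (fun i => (h i, odd i))); last first.
      by move=> i j _ _ [hij oij]; apply: h_odd => //; exact: val_inj.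
    rewrite mulnC -card_bool -cardsT -cardsX; apply: subset_leq_card.
    apply/fintype.subsetP => _ /imsetP[i iA ->]; apply/setXP.
    by split; [exact: imset_f | rewrite finset.in_setT].
  have {hA hA2}hA : M * (size s).+1 <= #|h @: A s y|.
    by rewrite -(leq_pmul2l (isT : 0 < 2)) mulnA (leq_trans hA).
  have b1 := card_prescribed_ffun h (fun i => ~~ odd i) (A s y).
  have b2 := card_prescribed_ffun h (fun i => odd i) (A s y).
  (* Two bad events cost a factor 2, whence [4 * K] where the union bound has [2 * K]. *)
  rewrite -(leq_pmul2l (isT : 0 < 2)).
  apply: (@leq_trans ((#|B1| + #|B2|) * 2 ^ #|h @: A s y|)); last first.
    by rewrite mulnDl (_ : 2 * 2 ^ m = 2 ^ m + 2 ^ m) ?leq_add // mul2n addnn.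
  rewrite mulnCA leq_mul ?leq_card_setU //.
  apply: (@leq_trans ((2 ^ M) ^ (size s).+1)); last by rewrite -expnM leq_exp2l.
  apply: (@leq_trans ((4 * K) ^ (size s).+1)); last by rewrite leq_exp2r.
  rewrite (_ : 4 * K = 2 * (2 * K)); last by rewrite mulnA.
  rewrite [leqRHS]expnMn leq_mul2r; apply/orP; right.
  by rewrite expnS leq_pmulr ?expn_gt0.
exists (I b); split => // s y sn hA.
have := hb s y sn; rewrite /bad hA !inE negb_or.
case/andP => /forall_inPn[i iA hi] /forall_inPn[j jA hj]; split.
  by exists i => //; rewrite inE; move: hi; case: (b _); case: (odd i).
by exists j => //; rewrite !inE.
Qed.

End HittingSets.

(** * The estimate for real systems *)

Section KeyEstimate.
Context {R : realType}.

(* [ln z <= 2 (sqrt z - 1)] turns the implicit bound into a polynomial one,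
   which is then fed back into the logarithm. *)
Lemma solve_log_bound (z M : R) : 0 <= z -> 1 <= M ->
  z <= M * (5 + 512 * (ln 2 + ln (1 + z))) -> z <= 520 * 23 * (M * (1 + ln M)).
Proof.
move=> z0 M1 h.
have ln21 : ln 2 <= 1 :> R by have := @ln_leB1 R 2; lra.
have M0 : 0 < M by lra.
pose y := 1 + z; have y1 : 1 <= y by rewrite lerDl.
have y0 : 0 < y by lra.
have lny0 : 0 <= ln y by exact: ln_ge0.
have h1 : y <= 520 * M * (1 + ln y).
  have h2 : 5 + 512 * (ln 2 + ln y) <= 519 * (1 + ln y) by lra.
  have h3 := ler_wpM2l (ltW M0) h2.
  have h4 : M <= M * (1 + ln y) by rewrite ler_peMr ?(ltW M0) // lerDl.
  have yE : y = 1 + z by [].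
  rewrite -yE in h; move: h h3 h4 yE M1; move: (ln y) (ln 2) => l l2; lra.
have ys0 : 0 < Num.sqrt y by rewrite sqrtr_gt0.
have ysE : Num.sqrt y ^+ 2 = y by rewrite sqr_sqrtr // ltW.
have lnyE : ln y = 2 * ln (Num.sqrt y) by rewrite -{1}ysE lnXn // mulr_natl.
have h3 : 1 + ln y <= 2 * Num.sqrt y.
  by rewrite lnyE; have := ln_leB1 ys0; lra.
have M520 : 0 <= 520 * M by apply: mulr_ge0; [exact: ler0n | exact: ltW].
(* The crude bound [Num.sqrt y <= 1040 * M <= 2 ^+ 11 * M] gives [ln y <= 2 * (11 + ln M)], and 23
   is 1 + 2 * 11. *)
have h4 : Num.sqrt y <= 520 * M * 2.
  rewrite -(ler_pM2r ys0) -expr2 ysE (le_trans h1) // -[leRHS]mulrA.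
  by rewrite ler_wpM2l.
have h5 : ln (Num.sqrt y) <= 11 + ln M.
  have : ln (Num.sqrt y) <= ln (2 ^+ 11 * M).
    rewrite ler_ln ?posrE ?mulr_gt0 ?exprn_gt0 // (le_trans h4) // mulrAC ler_pM2r //.
    by rewrite -natrM -natrX ler_nat.
  rewrite lnM ?posrE ?exprn_gt0 // lnXn //.
  by move: (ln 2) ln21 => l2; rewrite -[l2 *+ 11]mulr_natr; lra.
have lnM0 : 0 <= ln M by exact: ln_ge0.
have h6 : 1 + ln y <= 23 * (1 + ln M) by rewrite lnyE; lra.
have h7 := ler_wpM2l M520 h6.
have zy : z <= y by rewrite /y lerDr.
apply: (le_trans zy); apply: (le_trans h1); apply: (le_trans h7).
by rewrite le_eqVlt; apply/orP; left; apply/eqP; ring.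
Qed.

Context d (T : measurableType d) (P : probability T R).
Variables (n : nat) (L : R) (p q : 'I_n -> T -> R).
Hypotheses (n0 : (0 < n)%N) (L0 : 0 < L)
  (bp : forall i, bounded_measurable (p i))
  (bq : forall i, bounded_measurable (q i))
  (pqL : forall i x, p i x ^+ 2 + q i x ^+ 2 <= L ^+ 2).
Notation E := (expect P).
Notation e1 z := (dir1 p q z.1 z.2).
Notation e2 z := (dir2 p q z.1 z.2).
Hypothesis orth : forall z z' : 'I_n * bool,
  real_pairing P (e1 z) (e2 z) (e1 z') (e2 z') = (z == z')%:R.

Definition combination (a e : 'I_n * bool -> R) := \sum_z a z * e z.

Notation f1 a := (fun x => combination a (fun z => e1 z x)).
Notation f2 a := (fun x => combination a (fun z => e2 z x)).

Let bd1 z : bounded_measurable (e1 z). Proof. exact: bmf_dir1. Qed.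
Let bd2 z : bounded_measurable (e2 z). Proof. exact: bmf_dir2. Qed.

Lemma bmf_combination (a : 'I_n * bool -> R) (e : 'I_n * bool -> T -> R) :
  (forall z, bounded_measurable (e z)) ->
  bounded_measurable (fun x => combination a (fun z => e z x)).
Proof.
by move=> be; apply: bmf_sum => z; apply: bmfM; [exact: bmf_cst | exact: be].
Qed.

Lemma expect_combination (a : 'I_n * bool -> R) (e : 'I_n * bool -> T -> R) (h : T -> R) :
  (forall z, bounded_measurable (e z)) -> bounded_measurable h ->
  E (fun x => combination a (fun z => e z x) * h x) =
  \sum_z a z * E (fun x => e z x * h x).
Proof.
move=> be bh; under eq_fun do rewrite /combination mulr_suml.
rewrite expect_sum => [|z]; last first.
  by apply: bmfM bh; apply: bmfM; [exact: bmf_cst | exact: be].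
apply: eq_bigr => z _; under eq_fun do rewrite -mulrA.
by rewrite expectZ //; exact: bmfM.
Qed.

Lemma real_pairing_combination a (h1 h2 : T -> R) :
  bounded_measurable h1 -> bounded_measurable h2 ->
  real_pairing P (f1 a) (f2 a) h1 h2 = \sum_z a z * real_pairing P (e1 z) (e2 z) h1 h2.
Proof.
move=> bh1 bh2; rewrite /real_pairing !expect_combination // -big_split /=.
by apply: eq_bigr => z _; rewrite mulrDr.
Qed.

Lemma real_pairing_dir a z : real_pairing P (f1 a) (f2 a) (e1 z) (e2 z) = a z.
Proof.
rewrite real_pairing_combination // (bigD1 z) //= orth eqxx mulr1 big1 ?addr0 // => z' z'z.
by rewrite orth (negbTE z'z) mulr0.
Qed.

Lemma parseval a :
  E (fun x => f1 a x ^+ 2) + E (fun x => f2 a x ^+ 2) = \sum_z a z ^+ 2.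
Proof.
transitivity (real_pairing P (f1 a) (f2 a) (f1 a) (f2 a)) => [//|].
rewrite real_pairing_combination; try exact: bmf_combination.
apply: eq_bigr => z _; rewrite expr2; congr (_ * _).
rewrite -[RHS](real_pairing_dir a z) /real_pairing.
by congr (E _ + E _); apply/funext => x; rewrite mulrC.
Qed.

Lemma coefficient_le a z :
  `|a z| <= L * (E (fun x => `|f1 a x|) + E (fun x => `|f2 a x|)).
Proof.
have b1 := bmf_combination a bd1; have b2 := bmf_combination a bd2.
rewrite -(real_pairing_dir a z) (le_trans (ler_normD _ _)) // mulrDr.
have norm_le f e : bounded_measurable f -> bounded_measurable e ->
    (forall x, `|e x| <= L) -> `|E (fun x => f x * e x)| <= L * E (fun x => `|f x|).
  move=> bf be eL; rewrite -expectZ; last exact: bmf_norm.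
  apply: (le_trans (le_normr_Rintegral _ _)) => //; first by apply: bmf_integrable; exact: bmfM.
  apply: expect_le; [by apply: bmf_norm; exact: bmfM | |].
    by apply: bmfM; [exact: bmf_cst | exact: bmf_norm].
  by move=> x; rewrite normrM mulrC ler_wpM2r.
by rewrite lerD // norm_le // => x; [exact: dir1_le | exact: dir2_le].
Qed.

(** The sets [A s j] are the level sets of [w s] at height [2 * (L * 2 ^- j)]. They are fixed before
    [a], so a single [J] serves all combinations vanishing on it. *)
Lemma key_estimate :
  exists A : seq (letter n n.+4) -> 'I_n.+4 -> {set 'I_n},
  forall (M : nat) (J : {set 'I_n}), (0 < M)%N ->
  (forall s y, (size s < n)%N -> (M * (size s).+1 <= #|A s y|)%N ->
     exists2 i, i \in J & i \in A s y) ->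
  forall a : 'I_n * bool -> R, (forall i c, i \in J -> a (i, c) = 0) ->
  E (fun x => f1 a x ^+ 2) + E (fun x => f2 a x ^+ 2) <=
  520 * 23 * (M%:R * (1 + ln M%:R)) * (L * (E (fun x => `|f1 a x|) + E (fun x => `|f2 a x|))) ^+ 2.
Proof.
have pq1 i : E (fun x => p i x ^+ 2) + E (fun x => q i x ^+ 2) = 1.
  by rewrite -[RHS]/((true)%:R) -(eqxx (i, false)) -orth.
have [w hw] := greedy_descent n.+4 L0 bp bq pqL pq1.
exists (fun s j => [set i | (2 * (L * 2 ^- j) < w s i)%R]%SET) => M J M0 hJ a aJ.
have M1 : 1 <= M%:R :> R by rewrite ler1n.
have lnM : 0 <= ln M%:R :> R by exact: ln_ge0.
set N := E (fun x => `|f1 a x|) + E (fun x => `|f2 a x|).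
have N0 : 0 <= N by rewrite addr_ge0 // expect_ge0.
(* If [N] vanishes, so do all coefficients by [coefficient_le]; otherwise [a] is rescaled to make
   [N] equal to 1. *)
have [N_eq0|N_neq0] := eqVneq N 0.
  rewrite N_eq0 mulr0 expr0n /= mulr0 parseval big1 // => z _.
  have := coefficient_le a z; rewrite -/N N_eq0 mulr0 normr_le0 => /eqP ->.
  by rewrite expr0n.
have N_gt0 : 0 < N by rewrite lt_neqAle eq_sym N_neq0.
pose a' z := a z / N.
have scale e : combination a' e = N^-1 * combination a e.
  by rewrite /combination mulr_sumr; apply: eq_bigr => z _; rewrite /a' mulrAC mulrC.
have norm' : E (fun x => `|f1 a' x|) + E (fun x => `|f2 a' x|) = 1.
  rewrite (_ : E (fun x => `|f1 a' x|) = N^-1 * E (fun x => `|f1 a x|)); last first.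
    rewrite -expectZ; last by apply: bmf_norm; exact: bmf_combination.
    by congr E; apply/funext => x; rewrite scale normrM ger0_norm // invr_ge0.
  rewrite (_ : E (fun x => `|f2 a' x|) = N^-1 * E (fun x => `|f2 a x|)); last first.
    rewrite -expectZ; last by apply: bmf_norm; exact: bmf_combination.
    by congr E; apply/funext => x; rewrite scale normrM ger0_norm // invr_ge0.
  by rewrite -mulrDr mulVf.
have L2 : 0 < L ^+ 2 by rewrite exprn_gt0.
pose S := \sum_z a' z ^+ 2.
have S0 : 0 <= S by apply: sumr_ge0 => z _; exact: sqr_ge0.
have s20 : 0 <= S / L ^+ 2 by rewrite divr_ge0 // ltW.
have b1 := bmf_combination a' bd1; have b2 := bmf_combination a' bd2.
have nrm2 : E (fun x => f1 a' x ^+ 2) + E (fun x => f2 a' x ^+ 2) <= L ^+ 2 * (S / L ^+ 2).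
  by rewrite parseval mulrC divfK ?gt_eqF.
have [V [V0 VD Vstep]] := hw _ _ _ b1 b2 s20 norm' nrm2.
pose u i := `|a' (i, false)| + `|a' (i, true)|.
have aL z : `|a' z| <= L by have := coefficient_le a' z; rewrite norm' mulr1.
have u0 i : 0 <= u i by rewrite addr_ge0.
have uL i : u i <= 2 * L by rewrite /u; have := aL (i, false); have := aL (i, true); lra.
have uJ i : i \in J -> u i = 0 by move=> iJ; rewrite /u /a' !aJ // !mul0r normr0 addr0.
have hits s (j : 'I_n.+4) : (size s < n)%N ->
    (M * (size s).+1 <= #|[set i | (2 * (L * 2 ^- j) < w s i)%R]%SET|)%N ->
    exists2 i, i \in J & 2 * (L * 2 ^- j) < w s i.
  by move=> sn hs; have [i iJ] := hJ s j sn hs; rewrite inE => ?; exists i.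
have Vstep' s (j : 'I_n.+4) : (exists x, V (x :: s) <= V s - 4 ^- j / 8) \/
    forall i, `|u i - w s i| <= 2 * (L * 2 ^- j).
  have [|h] := Vstep s j; [by left | right=> i].
  have := h i; rewrite -/(e1 (i, false)) -/(e2 (i, false)).
  by rewrite (real_pairing_dir a' (i, false)) (real_pairing_dir a' (i, true)).
have Su : S <= \sum_i u i ^+ 2.
  have -> : S = \sum_i \sum_c a' (i, c) ^+ 2.
    by rewrite pair_bigA; apply: eq_bigr => -[].
  apply: ler_sum => i _; rewrite big_bool /u /=.
  rewrite -[a' (i, true) ^+ 2]real_normK ?num_real // -[a' (i, false) ^+ 2]real_normK ?num_real //.
  rewrite sqrrD addrC lerD2r lerDl mulrn_wge0 // mulr_ge0 //.
(* With [z = S / L ^+ 2] and [D = ln 2 + ln (1 + z)], the descent bound becomes the implicit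
   inequality of [solve_log_bound]. *)
have := sum_sqr_le_descent L0 M0 n0 u0 uL uJ hits V0 VD Vstep'.
move=> /(le_trans Su); rewrite mulrCA -ler_pdivrMl // mulrC => hS.
have := solve_log_bound s20 M1 hS.
rewrite ler_pdivrMr // => {}hS.
rewrite parseval (_ : \sum_z a z ^+ 2 = S * N ^+ 2); last first.
  by rewrite /S mulr_suml; apply: eq_bigr => z _; rewrite /a' -exprMn divfK.
by rewrite [(L * N) ^+ 2]exprMn [leRHS]mulrA ler_wpM2r ?sqr_ge0.
Qed.

End KeyEstimate.

(** * Constants *)

Section Numerics.
Context {R : realType}.
Implicit Types (x y l c L : R).

Lemma sqr_le_of_le x y l : 0 <= x -> x <= y -> y * y <= l -> x ^+ 2 <= l.
Proof. by move=> x0 xy; apply: le_trans; rewrite expr2 ler_pM. Qed.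

(** The quadratic bound at 1/12, followed by three squarings with rounding up, gives e^(2/3) < 2. *)
Lemma ln2_gt_twothirds : 2 / 3 < ln 2 :> R.
Proof.
rewrite -ltr_expR lnK ?posrE //.
have h1 : expR (12^-1) <= 157 / 144 :> R.
  have := @expR_le_quadratic R 12^-1; rewrite ger0_norm ?invr_ge0 // => h.
  by apply: (le_trans (h _)); lra.
have -> : 2 / 3 = 12^-1 * 8%:R :> R by lra.
rewrite expRM_natr -[8%N]/(2 * (2 * 2))%N !exprM.
have h2 : expR (12^-1) ^+ 2 <= 1189 / 1000 :> R.
  by apply: sqr_le_of_le h1 _; [exact: expR_ge0 | lra].
have h3 : expR (12^-1) ^+ 2 ^+ 2 <= 1414 / 1000 :> R.
  by apply: sqr_le_of_le h2 _; [exact: sqr_ge0 | lra].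
apply: (@le_lt_trans _ _ (1414 / 1000 * (1414 / 1000))); last lra.
by apply: sqr_le_of_le h3 _; [exact: sqr_ge0 | exact: lexx].
Qed.

Lemma ln3_gt1 : 1 < ln 3 :> R.
Proof.
rewrite -ltr_expR lnK ?posrE //.
have h1 : expR (4^-1) <= 21 / 16 :> R.
  have := @expR_le_quadratic R 4^-1; rewrite ger0_norm ?invr_ge0 // => h.
  by apply: (le_trans (h _)); lra.
have -> : 1 = 4^-1 * 4%:R :> R by lra.
rewrite expRM_natr -[4%N]/(2 * 2)%N exprM.
have h2 : expR (4^-1) ^+ 2 <= 173 / 100 :> R.
  by apply: sqr_le_of_le h1 _; [exact: expR_ge0 | lra].
apply: (@le_lt_trans _ _ (173 / 100 * (173 / 100))); last lra.
by apply: sqr_le_of_le h2 _; [exact: sqr_ge0 | exact: lexx].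
Qed.

Lemma le_powR_five_halves c : 0 < c ->
  exists2 K : R, 0 < K & forall l, c <= l -> l <= K * l `^ (5 / 2).
Proof.
move=> c0; exists (c * c^-1 `^ (5 / 2)) => [|l cl].
  by rewrite mulr_gt0 // powR_gt0 // invr_gt0.
have l0 : 0 < l := lt_le_trans c0 cl.
rewrite -mulrA -powRM ?invr_ge0 ?(ltW c0) ?(ltW l0) //.
rewrite -ler_pdivrMl // le1r_powR //; last by lra.
by rewrite ler_pdivlMl // mulr1.
Qed.

Lemma ln_natr_ge (a n : nat) : (0 < a)%N -> (a <= n)%N -> ln a%:R <= ln n%:R :> R.
Proof.
by move=> a0 an; rewrite ler_ln ?posrE ?ltr0n ?ler_nat // (leq_trans a0).
Qed.

(** [n * 2 * 2 * n.+4] is the number of letters, and 8 n (n + 4) <= 27 n^2 <= n^5. *)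
Lemma ln_card_letters (n : nat) : (3 <= n)%N ->
  ln (2 * (n * 2 * 2 * n.+4))%:R <= 5 * ln n%:R :> R.
Proof.
move=> n3; have n0 : (0 < n)%N by apply: leq_trans n3.
rewrite -[5 * _]/(5%:R * _) mulr_natl -lnXn ?ltr0n // ler_ln ?posrE; first last.
- by rewrite exprn_gt0 // ltr0n.
- by rewrite ltr0n !muln_gt0 n0.
rewrite -natrX ler_nat.
have h : (27 <= n * n * n)%N by exact: (leq_mul (leq_mul n3 n3) n3).
have -> : (n ^ 5 = n * n * n * (n * n))%N by rewrite !expnS expn0; lia.
by apply: (@leq_trans (27 * (n * n))); [nia | rewrite leq_mul2r h orbT].
Qed.

Lemma ln_card_letters4 (n : nat) : (4 <= n)%N ->
  ln (4 * (n * 2 * 2 * n.+4))%:R <= 5 * ln n%:R :> R.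
Proof.
move=> n4; have n0 : (0 < n)%N by apply: leq_trans n4.
rewrite -[5 * _]/(5%:R * _) mulr_natl -lnXn ?ltr0n // ler_ln ?posrE; first last.
- by rewrite exprn_gt0 // ltr0n.
- by rewrite ltr0n !muln_gt0 n0.
rewrite -natrX ler_nat.
have h : (64 <= n * n * n)%N by exact: (leq_mul (leq_mul n4 n4) n4).
have -> : (n ^ 5 = n * n * n * (n * n))%N by rewrite !expnS expn0; lia.
by apply: (@leq_trans (64 * (n * n))); [nia | rewrite leq_mul2r h orbT].
Qed.

Lemma ln_sqrt x : 0 < x -> ln (Num.sqrt x) = ln x / 2.
Proof.
move=> x0; have s0 : 0 < Num.sqrt x by rewrite sqrtr_gt0.
by rewrite -{2}(sqr_sqrtr (ltW x0)) lnXn // -[ln _ *+ 2]mulr_natr mulfK.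
Qed.

(** With r = n/k, x = ln k and l = ln mu, one has ln n = x + ln r = O(x l) and 1 + ln M = O(l).
    Hence M (1 + ln M) = O(r x l^2), whose square root times L is of order mu l. *)
Lemma sampling_constant (D : R) : 0 < D ->
  exists2 C : R, 0 < C & forall (n k M : nat) L, (1 < k)%N -> (k < n)%N -> 1 <= L ->
    (0 < M)%N -> M%:R <= n%:R / k%:R * ln (2 * (n * 2 * 2 * n.+4))%:R + 1 :> R ->
    let mu := L * Num.sqrt (n%:R / k%:R) * Num.sqrt (ln k%:R) in
    0 <= mu * ln mu `^ (5 / 2) /\
    2 * L * Num.sqrt (D * (M%:R * (1 + ln M%:R))) <= C * mu * ln mu `^ (5 / 2).
Proof.
move=> D0; have ln2 := ln2_gt_twothirds; have ln3 := ln3_gt1.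
(* The product [r * x] below is at least [g > 1]: if [k = 2] then [n >= 3] and [r >= 3 / 2],
   otherwise [x >= ln 3]. With [1 <= L] this keeps [ln mu] above [ln g / 2]. *)
pose g : R := Num.min (3 / 2 * ln 2) (ln 3).
have g1 : 1 < g by rewrite lt_min ln3 andbT; lra.
have g0 : 0 < g := lt_trans ltr01 g1.
have c0 : 0 < ln g / 2 by rewrite divr_gt0 // ln_gt0.
have [K K0 hK] := le_powR_five_halves c0.
pose a := (ln g / 2)^-1; have a0 : 0 < a by rewrite invr_gt0.
pose B : R := D * (6 * ((3 + 2 * a) * (5 + 7 * a))).
have B0 : 0 < B by rewrite /B !mulr_gt0 ?ltr0n //; lra.
have BE := erefl B; rewrite {2}/B in BE; clearbody B.
exists (2 * Num.sqrt B * K) => [|n k M L k1 kn L1 M0 hM mu].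
  by rewrite mulr_gt0 // mulr_gt0 // sqrtr_gt0.
have k0 : 0 < k%:R :> R by rewrite ltr0n (ltn_trans _ k1).
have n3 : (3 <= n)%N by exact: leq_ltn_trans k1 kn.
have n0 : 0 < n%:R :> R by rewrite ltr0n (leq_trans _ n3).
have L0 : 0 < L by lra.
set x := ln k%:R in mu *; set r := n%:R / k%:R in mu hM *.
have x23 : 2 / 3 < x by apply: (lt_le_trans ln2); exact: (@ln_natr_ge 2).
have x0 : 0 < x by lra.
have r1 : 1 <= r by rewrite ler_pdivlMr // mul1r ler_nat ltnW.
have r0 : 0 < r by lra.
have grx : g <= r * x.
  rewrite ge_min; have [k3|k2] := ltnP 2 k; apply/orP; [right|left].
    have h3 : ln 3 <= x by exact: (@ln_natr_ge 3).
    by apply: (le_trans h3); rewrite ler_peMl // ltW.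
  have kE : k = 2 by apply/eqP; rewrite eqn_leq k2 k1.
  rewrite /x /r kE ler_wpM2r //; first by lra.
  by rewrite ler_pM2r ?invr_gt0 // ler_nat.
have wE : ln n%:R = x + ln r by rewrite /x /r ln_div ?posrE // addrC subrK.
clearbody x r.
have rx0 : 0 < r * x by exact: mulr_gt0.
have lnrx : ln (r * x) = ln r + ln x by rewrite lnM ?posrE.
have l0g : ln g <= ln r + ln x by rewrite -lnrx ler_ln ?posrE.
have sr0 : 0 < Num.sqrt r by rewrite sqrtr_gt0.
have sx0 : 0 < Num.sqrt x by rewrite sqrtr_gt0.
have mu0 : 0 < mu by rewrite /mu !mulr_gt0.
have lnmu : ln mu = ln L + (ln r + ln x) / 2.
  rewrite /mu lnM ?posrE ?mulr_gt0 // lnM ?posrE //.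
  by rewrite !ln_sqrt // mulrDl addrA.
have lnL : 0 <= ln L by exact: ln_ge0.
set l := ln mu in lnmu *.
have lg : ln g / 2 <= l by lra.
have l0 : 0 < l by lra.
have al : 1 <= a * l by rewrite ler_pdivlMl // mulr1.
split; first by rewrite mulr_ge0 ?powR_ge0 // ltW.
set w : R := ln n%:R in wE *.
have w1 : 1 <= w by apply: (le_trans (ltW ln3)); exact: (@ln_natr_ge 3).
have y0 : 0 <= ln r by exact: ln_ge0.
have lnxV : - ln x <= 1 / 2.
  have := ln_leB1 (_ : 0 < x^-1); rewrite invr_gt0 lnV ?posrE // => /(_ x0).
  have : x^-1 <= 3 / 2 by rewrite invf_ple ?posrE //; lra.
  lra.
have y_le : ln r <= (2 + a / 2) * l by lra.
have w_le : w <= x * ((3 + 2 * a) * l).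
  have : x <= x * (a * l) by rewrite ler_peMr // ltW.
  have : ln r <= x * (3 / 2 * ((2 + a / 2) * l)).
    apply: (le_trans y_le); rewrite [leRHS]mulrA ler_peMl //; last by lra.
    by rewrite mulr_ge0 ?ltW //; lra.
  have : 0 <= x * (a * l) by rewrite !mulr_ge0 // ltW.
  by rewrite wE; lra.
have lnw : ln w <= ln x + 3 / 2 * ln r.
  have xr0 : 0 < 1 + ln r / x by rewrite ltr_wpDr // divr_ge0 // ltW.
  have -> : w = x * (1 + ln r / x) by rewrite wE; field; rewrite gt_eqF.
  rewrite lnM ?posrE // lerD2l.
  apply: (le_trans (ln_leB1 xr0)); rewrite addrC addKr mulrC ler_wpM2r //.
  by rewrite invf_ple ?posrE //; lra.
have M6 : M%:R <= 6 * (r * w).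
  apply: (le_trans hM).
  have h5 := ler_wpM2l (ltW r0) (ln_card_letters n3).
  have : 1 <= r * w by rewrite -[leLHS]mulr1 ler_pM.
  by move: h5; rewrite -/w; lra.
have M0' : 0 < M%:R :> R by rewrite ltr0n.
have rw0 : 0 < r * w by rewrite mulr_gt0 //; lra.
have lnM1 : 1 + ln M%:R <= (5 + 7 * a) * l.
  have : ln M%:R <= ln 6 + (ln r + ln w).
    rewrite -lnM ?posrE //; last by lra.
    by rewrite -lnM ?posrE // ler_ln ?posrE // mulr_gt0.
  have : ln 6 <= 5 :> R by have := @ln_leB1 R 6; lra.
  by have := y_le; have := mulr_gt0 a0 l0; lra.
have lnM0 : 0 <= ln M%:R :> R by apply: ln_ge0; rewrite ler1n.
have bound : D * (M%:R * (1 + ln M%:R)) <= B * (r * x * l ^+ 2).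
  have -> : B * (r * x * l ^+ 2) =
      D * (6 * (r * (x * ((3 + 2 * a) * l))) * ((5 + 7 * a) * l)).
    by rewrite BE; ring.
  rewrite (ler_pM2l D0); apply: ler_pM; rewrite ?addr_ge0 ?(ltW M0') //.
  by apply: (le_trans M6); rewrite ler_pM2l // ler_pM2l.
have bound' : Num.sqrt (D * (M%:R * (1 + ln M%:R))) <= Num.sqrt B * (Num.sqrt r * Num.sqrt x) * l.
  apply: (le_trans (ler_wsqrtr bound)).
  rewrite sqrtrM ?(ltW B0) // sqrtrM ?(ltW rx0) // sqrtrM ?(ltW r0) //.
  by rewrite sqrtr_sqr ger0_norm ?(ltW l0) // mulrA.
apply: (@le_trans _ _ (2 * L * (Num.sqrt B * (Num.sqrt r * Num.sqrt x) * l))).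
  by rewrite ler_wpM2l // mulr_ge0 // ltW.
have -> : 2 * L * (Num.sqrt B * (Num.sqrt r * Num.sqrt x) * l) = 2 * Num.sqrt B * mu * l.
  by rewrite /mu; ring.
have -> : 2 * Num.sqrt B * K * mu * l `^ (5 / 2) = 2 * Num.sqrt B * mu * (K * l `^ (5 / 2)).
  by ring.
rewrite ler_wpM2l ?hK // mulr_ge0 ?(ltW mu0) // mulr_ge0 // sqrtr_ge0.
Qed.

(** As [4 <= n], the quantity ln (ln n) is at least ln (ln 4) > 0 and absorbs all constants. The 22
    in the proof is 2 (2 * 5 + 1), with 5 from [ln_card_letters4]. *)
Lemma halving_constant (D : R) : 0 < D ->
  exists2 C : R, 0 < C & forall (n M : nat) L, (4 <= n)%N -> 0 <= L ->
    (0 < M)%N -> M%:R <= 2 * (2 * ln (4 * (n * 2 * 2 * n.+4))%:R + 1) :> R ->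
    2 * L * Num.sqrt (D * (M%:R * (1 + ln M%:R))) <=
    C * L * Num.sqrt (ln n%:R) * ln (ln n%:R) `^ (5 / 2).
Proof.
move=> D0; have ln2 := ln2_gt_twothirds.
have ln4 : 1 < ln 4 :> R.
  have -> : 4 = 2 * 2 :> R by ring.
  by rewrite lnM ?posrE //; lra.
have c0 : 0 < ln (ln 4) :> R by exact: ln_gt0.
have [K K0 hK] := le_powR_five_halves c0.
pose a : R := (ln (ln 4))^-1; have a0 : 0 < a by rewrite invr_gt0.
pose B : R := D * (22 * ((22 * a + 1) * a)).
have B0 : 0 < B by rewrite /B !mulr_gt0 ?ltr0n //; lra.
have BE := erefl B; rewrite {2}/B in BE; clearbody B.
exists (2 * Num.sqrt B * K) => [|n M L n4 L0 M0 hM].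
  by rewrite mulr_gt0 // mulr_gt0 // sqrtr_gt0.
set w : R := ln n%:R.
have w4 : ln 4 <= w by exact: (@ln_natr_ge 4).
have w1 : 1 <= w by lra.
have w0 : 0 < w by lra.
set l := ln w.
have lc : ln (ln 4) <= l by rewrite ler_ln ?posrE //; lra.
have l0 : 0 < l by lra.
have al : 1 <= a * l by rewrite ler_pdivlMl // mulr1.
have M22 : M%:R <= 22 * w.
  apply: (le_trans hM); have := ln_card_letters4 n4; rewrite -/w; lra.
have M0' : 0 < M%:R :> R by rewrite ltr0n.
have lnM1 : 1 + ln M%:R <= (22 * a + 1) * l.
  have : ln M%:R <= ln 22 + l by rewrite -lnM ?posrE // ler_ln ?posrE // mulr_gt0.
  have : ln 22 <= 21 :> R by have := @ln_leB1 R 22; lra.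
  by move: al; lra.
have lnM0 : 0 <= ln M%:R :> R by apply: ln_ge0; rewrite ler1n.
have bound : D * (M%:R * (1 + ln M%:R)) <= B * (w * l ^+ 2).
  have -> : B * (w * l ^+ 2) = D * (22 * w * ((22 * a + 1) * l * (a * l))).
    by rewrite BE; ring.
  rewrite (ler_pM2l D0); apply: ler_pM; rewrite ?addr_ge0 ?(ltW M0') //.
  by apply: (le_trans lnM1); rewrite ler_peMr // mulr_ge0 ?(ltW l0) //; lra.
have bound' : Num.sqrt (D * (M%:R * (1 + ln M%:R))) <= Num.sqrt B * Num.sqrt w * l.
  apply: (le_trans (ler_wsqrtr bound)).
  rewrite sqrtrM ?(ltW B0) // sqrtrM ?(ltW w0) //.
  by rewrite sqrtr_sqr ger0_norm ?(ltW l0) // mulrA.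
apply: (@le_trans _ _ (2 * L * (Num.sqrt B * Num.sqrt w * l))).
  by rewrite ler_wpM2l // mulr_ge0.
have -> : 2 * L * (Num.sqrt B * Num.sqrt w * l) = 2 * Num.sqrt B * L * Num.sqrt w * l.
  by ring.
have -> : 2 * Num.sqrt B * K * L * Num.sqrt w * l `^ (5 / 2) =
   2 * Num.sqrt B * L * Num.sqrt w * (K * l `^ (5 / 2)) by ring.
by rewrite ler_wpM2l ?hK // !mulr_ge0 ?sqrtr_ge0.
Qed.

End Numerics.

(** * Complex systems *)

Section ComplexSystem.
Context d (T : measurableType d) (R : realType) (P : probability T R).
Local Notation Re := complex.Re.
Local Notation Im := complex.Im.

Lemma normc_sqrt (z : R[i]) : Normc.normc z = Num.sqrt (Re z ^+ 2 + Im z ^+ 2).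
Proof. by case: z. Qed.

Lemma Re_mulJ (z w : R[i]) : Re (z * w^*) = Re z * Re w + Im z * Im w.
Proof. by case: z w => a b [a' b'] /=; ring. Qed.

Lemma Im_mulJ (z w : R[i]) : Im (z * w^*) = Im z * Re w - Re z * Im w.
Proof. by case: z w => a b [a' b'] /=; ring. Qed.

Lemma ae_eq_Rintegral (f g : T -> R) :
  measurable_fun setT f -> measurable_fun setT g ->
  {ae P, forall x, f x = g x} -> Rintegral P setT f = Rintegral P setT g.
Proof.
move=> mf mg fg; congr fine; apply: ae_eq_integral => //;
  try exact/measurable_EFinP.
by apply: filterS fg => x ->.
Qed.

Section Norms.
Variables (F : T -> R[i]) (f1 f2 : T -> R).
Hypotheses (mF : cmeasurable F) (bf1 : bounded_measurable f1)
  (bf2 : bounded_measurable f2)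
  (Ff : {ae P, forall x, Re (F x) = f1 x /\ Im (F x) = f2 x}).

Lemma cLnorm2E : cLnorm P 2%:E F =
  (Num.sqrt (expect P (fun x => f1 x ^+ 2) + expect P (fun x => f2 x ^+ 2)))%:E.
Proof.
have [mF1 mF2] := mF.
rewrite -expectD; try exact: bmf_sqr.
have bs : bounded_measurable (fun x => f1 x ^+ 2 + f2 x ^+ 2).
  by apply: bmfD; exact: bmf_sqr.
have s0 : 0 <= expect P (fun x => f1 x ^+ 2 + f2 x ^+ 2).
  by apply: expect_ge0 => x; rewrite addr_ge0 ?sqr_ge0.
rewrite /cLnorm unlock /= -powR12_sqrt // -poweR_EFin; congr (_ `^ _)%E.
rewrite /expect /Rintegral fineK; last exact/integrable_fin_num/bmf_integrable.
transitivity (\int[P]_x (Re (F x) ^+ 2 + Im (F x) ^+ 2)%:E)%E.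
  apply: eq_integral => x _.
  rewrite /= powR_mulrn // real_normK ?num_real // normc_sqrt sqr_sqrtr //.
  by rewrite addr_ge0 ?sqr_ge0.
apply: ae_eq_integral => //.
- by apply/measurable_EFinP; apply: measurable_funD; exact: measurable_funX.
- by apply/measurable_EFinP; case: bs.
- by apply: filterS Ff => x [-> ->].
Qed.

(** The sum of the moduli of the two parts is at most twice the modulus; this loss is the 2 in the
    constant of [complex_key_estimate]. *)
Lemma cLnorm1_ge :
  (((expect P (fun x => `|f1 x|) + expect P (fun x => `|f2 x|)) / 2)%:E <= cLnorm P 1%:E F)%E.
Proof.
have [mF1 mF2] := mF.
rewrite -expectD; try exact: bmf_norm.
have bs : bounded_measurable (fun x => `|f1 x| + `|f2 x|).
  by apply: bmfD; exact: bmf_norm.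
rewrite mulrC -expectZ // /expect /Rintegral fineK; last first.
  by apply/integrable_fin_num => //; apply: bmf_integrable; apply: bmfM => //; exact: bmf_cst.
rewrite /cLnorm Lnorm1.
have -> : (\int[P]_x (2^-1 * (`|f1 x| + `|f2 x|))%:E =
           \int[P]_x (2^-1 * (`|Re (F x)| + `|Im (F x)|))%:E)%E.
  apply: ae_eq_integral => //.
  - by apply/measurable_EFinP; apply: measurable_funM => //; exact: (proj1 bs).
  - apply/measurable_EFinP; apply: measurable_funM => //.
    by apply: measurable_funD; exact: measurableT_comp.
  - by apply: filterS Ff => x [-> ->].
apply: ge0_le_integral => //.
- apply/measurable_EFinP; apply: measurable_funM => //.
  by apply: measurable_funD; exact: measurableT_comp.
- apply: measurableT_comp => //; apply/measurable_EFinP.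
  under eq_fun do rewrite normc_sqrt.
  apply: measurableT_comp; first by apply: continuous_measurable_fun; exact: sqrt_continuous.
  by apply: measurable_funD; exact: measurable_funX.
- move=> x _; rewrite lee_fin normc_sqrt ger0_norm ?sqrtr_ge0 //.
  have h0 : 0 <= Re (F x) ^+ 2 + Im (F x) ^+ 2 by rewrite addr_ge0 ?sqr_ge0.
  rewrite mulrC ler_pdivrMr // -ler_sqr ?nnegrE ?addr_ge0 ?mulr_ge0 //.
  rewrite exprMn sqr_sqrtr // -[Re (F x) ^+ 2]real_normK ?num_real //.
  rewrite -[Im (F x) ^+ 2]real_normK ?num_real //.
  move: `|Re (F x)| `|Im (F x)| => u v; have := sqr_ge0 (u - v); have := sqr_ge0 (u + v).
  by nra.
Qed.

End Norms.

(** * Truncation to a system bounded at every point *)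

Variables (n : nat) (L : R) (phi : 'I_n -> T -> R[i]).
Hypotheses (n0 : (0 < n)%N) (L0 : 0 < L) (phiO : orthonormal_system P phi)
  (phiL : forall j, (cLnorm P +oo%E (phi j) <= L%:E)%E).

(** Each phi_j is bounded by [L] only almost everywhere; cutting it off outside this set changes it
    on a null set and makes the bound hold everywhere. *)
Definition bound_set (j : 'I_n) : set T :=
  [set x | Re (phi j x) ^+ 2 + Im (phi j x) ^+ 2 <= L ^+ 2].

Definition truncated_Re (j : 'I_n) (x : T) : R := Re (phi j x) * \1_(bound_set j) x.
Definition truncated_Im (j : 'I_n) (x : T) : R := Im (phi j x) * \1_(bound_set j) x.
Local Notation p := truncated_Re.
Local Notation q := truncated_Im.

Let mRe j : measurable_fun setT (fun x => Re (phi j x)).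
Proof. by case: phiO => /(_ j)[[]]. Qed.

Let mIm j : measurable_fun setT (fun x => Im (phi j x)).
Proof. by case: phiO => /(_ j)[[]]. Qed.

Lemma measurable_bound_set j : measurable (bound_set j).
Proof.
rewrite -[bound_set j]setTI.
have -> : bound_set j = (fun x => Re (phi j x) ^+ 2 + Im (phi j x) ^+ 2) @^-1` `]-oo, L ^+ 2].
  by apply/seteqP; split=> x; rewrite /bound_set /= in_itv.
have mf : measurable_fun setT (fun x => Re (phi j x) ^+ 2 + Im (phi j x) ^+ 2).
  by apply: measurable_funD; exact: measurable_funX.
by apply: mf => //; exact: measurable_itv.
Qed.

Lemma truncated_le j x : p j x ^+ 2 + q j x ^+ 2 <= L ^+ 2.
Proof.
rewrite /p /q !exprMn indicE; case: (boolP (x \in bound_set j)) => [|_].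
  by rewrite inE => h; rewrite expr1n !mulr1.
by rewrite expr0n !mulr0 addr0 sqr_ge0.
Qed.

Lemma bmf_truncated_Re j : bounded_measurable (p j).
Proof.
split; first by apply: measurable_funM => //; apply: measurable_indic; exact: measurable_bound_set.
exists L => x; have := truncated_le j x; have := sqr_ge0 (q j x) => h1 h2.
by rewrite -ler_sqr ?nnegrE ?(ltW L0) // real_normK ?num_real //; lra.
Qed.

Lemma bmf_truncated_Im j : bounded_measurable (q j).
Proof.
split; first by apply: measurable_funM => //; apply: measurable_indic; exact: measurable_bound_set.
exists L => x; have := truncated_le j x; have := sqr_ge0 (p j x) => h1 h2.
by rewrite -ler_sqr ?nnegrE ?(ltW L0) // real_normK ?num_real //; lra.
Qed.

Lemma ae_truncated :
  {ae P, forall x, forall j, Re (phi j x) = p j x /\ Im (phi j x) = q j x}.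
Proof.
apply: filter_forall => j; have := phiL j.
rewrite /cLnorm unlock /= probability_setT lte01 => /ess_supP.
apply: filterS => x /=; rewrite lee_fin normc_sqrt ger0_norm ?sqrtr_ge0 // => h.
have xb : x \in bound_set j.
  rewrite inE /bound_set /= -[leLHS]sqr_sqrtr ?addr_ge0 ?sqr_ge0 //.
  by rewrite ler_sqr ?nnegrE ?sqrtr_ge0 // ltW.
by rewrite /p /q indicE xb !mulr1.
Qed.

Local Notation e1 z := (dir1 p q z.1 z.2).
Local Notation e2 z := (dir2 p q z.1 z.2).

(** Equal flags [c], [c'] see the real part of the Hermitian product of phi_i and phi_j; different
    flags see, up to sign, its imaginary part, which is 0. *)
Lemma truncated_orthonormal (z z' : 'I_n * bool) :
  real_pairing P (e1 z) (e2 z) (e1 z') (e2 z') = (z == z')%:R.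
Proof.
have bp := bmf_truncated_Re; have bq := bmf_truncated_Im.
case: z z' => i c [j c']; case: phiO => _ /(_ i j); rewrite /cintegral.
set A := Rintegral _ _ _; set B := Rintegral _ _ _ => AB.
have AE : A = expect P (fun x => p i x * p j x) + expect P (fun x => q i x * q j x).
  rewrite -expectD; try exact: bmfM.
  apply: ae_eq_Rintegral.
  - under eq_fun do rewrite Re_mulJ.
    by apply: measurable_funD; apply: measurable_funM.
  - by have [] := bmfD (bmfM (bp i) (bp j)) (bmfM (bq i) (bq j)).
  - apply: filterS ae_truncated => x h; have [<- <-] := h i; have [<- <-] := h j; exact: Re_mulJ.
have BE : B = expect P (fun x => q i x * p j x) - expect P (fun x => p i x * q j x).
  rewrite -expectB; try exact: bmfM.
  apply: ae_eq_Rintegral.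
  - under eq_fun do rewrite Im_mulJ.
    by apply: measurable_funB; apply: measurable_funM.
  - by have [] := bmfB (bmfM (bq i) (bp j)) (bmfM (bp i) (bq j)).
  - apply: filterS ae_truncated => x h; have [<- <-] := h i; have [<- <-] := h j; exact: Im_mulJ.
have A' : A = (i == j)%:R by have := congr1 (@complex.Re R) AB; case: (i == j).
have B' : B = 0 by have := congr1 (@complex.Im R) AB; case: (i == j).
rewrite xpair_eqE /real_pairing.
have negl (f g : T -> R) : bounded_measurable f -> bounded_measurable g ->
    expect P (fun x => - f x * g x) = - expect P (fun x => f x * g x).
  move=> bf bg; rewrite -mulN1r -expectZ; last exact: bmfM.
  by congr expect; apply/funext => x; rewrite mulN1r mulNr.
have negr (f g : T -> R) : bounded_measurable f -> bounded_measurable g ->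
    expect P (fun x => f x * - g x) = - expect P (fun x => f x * g x).
  by move=> bf bg; rewrite -negl //; congr expect; apply/funext => x; rewrite mulNr mulrN.
case: c c' => [] [] /=; rewrite ?andbT ?andbF -?A' ?AE.
- by under eq_fun do rewrite mulrNN; rewrite addrC.
- by rewrite negl // addrC -opprB -BE B' oppr0.
- by rewrite negr // addrC -BE B'.
- by [].
Qed.

(** On a probability space a function bounded by [L] has L_2 norm at most [L], and here that norm is
    1. The constants need it for [0 <= ln L]. *)
Lemma L_ge1 : 1 <= L.
Proof.
pose z : 'I_n * bool := (Ordinal n0, false).
have := truncated_orthonormal z z; rewrite eqxx /real_pairing /= => h.
have bp := bmf_truncated_Re; have bq := bmf_truncated_Im.
rewrite -(ler_sqr (x := 1)) ?nnegrE ?(ltW L0) // expr1n -[leLHS]/(true%:R) -h -expectD; try exact: bmfM.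
rewrite -[leRHS](expect_cst P); apply: expect_le.
- by apply: bmfD; exact: bmfM.
- exact: bmf_cst.
- by move=> x; exact: truncated_le.
Qed.

Section PartialSums.
Variables (I : {set 'I_n}) (a : 'I_n -> R[i]).

Definition real_coef (z : 'I_n * bool) : R :=
  if z.1 \in I then if z.2 then Im (a z.1) else Re (a z.1) else 0.

(** [u] and [v] are left free for two uses: the original parts at every point, for measurability,
    and the truncated parts almost everywhere, for the estimate. *)
Lemma partial_sum_parts (x : T) (u v : 'I_n -> T -> R) :
  (forall j, Re (phi j x) = u j x /\ Im (phi j x) = v j x) ->
  Re (partial_sum phi I a x) = combination real_coef (fun z => dir1 u v z.1 z.2 x) /\
  Im (partial_sum phi I a x) = combination real_coef (fun z => dir2 u v z.1 z.2 x).
Proof.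
move=> uv.
have comb e : combination real_coef e =
    \sum_(i in I) (Re (a i) * e (i, false) + Im (a i) * e (i, true)).
  transitivity (\sum_i \sum_b real_coef (i, b) * e (i, b)).
    by rewrite pair_bigA; apply: eq_bigr => -[].
  rewrite [RHS]big_mkcond /=; apply: eq_bigr => i _; rewrite big_bool /real_coef /=.
  by case: (i \in I); rewrite ?mul0r ?addr0 // addrC.
rewrite !comb /partial_sum !raddf_sum /=; split; apply: eq_bigr => i _;
  have [<- <-] := uv i; rewrite /dir1 /dir2 /=;
  by case: (a i) => r s; case: (phi i x) => r' s' /=; ring.
Qed.

Lemma measurable_partial_sum : cmeasurable (partial_sum phi I a).
Proof.
pose u j x := Re (phi j x); pose v j x := Im (phi j x).
have parts x := @partial_sum_parts x u v (fun j => conj erefl erefl).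
have mcomb e : (forall z, measurable_fun setT (e z)) ->
    measurable_fun setT (fun x : T => combination real_coef (fun z => e z x)).
  by move=> me; apply: measurable_sum => z; exact: measurable_funM.
split.
  rewrite (_ : (fun x => _) = (fun x => combination real_coef (fun z => dir1 u v z.1 z.2 x))).
    apply: mcomb => -[i []] /=; last exact: mRe.
    by apply: measurableT_comp => //; exact: mIm.
  by apply/funext => x; case: (parts x).
rewrite (_ : (fun x => _) = (fun x => combination real_coef (fun z => dir2 u v z.1 z.2 x))).
  by apply: mcomb => -[i []] /=; [exact: mRe | exact: mIm].
by apply/funext => x; case: (parts x).
Qed.

End PartialSums.

(** This is [key_estimate] with [J] the complement of [I], where [real_coef] vanishes. *)
Lemma complex_key_estimate :
  exists A : seq (letter n n.+4) -> 'I_n.+4 -> {set 'I_n},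
  forall (M : nat) (I : {set 'I_n}), (0 < M)%N ->
  (forall s y, (size s < n)%N -> (M * (size s).+1 <= #|A s y|)%N ->
     exists2 i, i \in (~: I)%SET & i \in A s y) ->
  forall (a : 'I_n -> R[i]) (C : R),
  2 * L * Num.sqrt (520 * 23 * (M%:R * (1 + ln M%:R))) <= C ->
  (cLnorm P 2%:E (partial_sum phi I a) <= C%:E * cLnorm P 1%:E (partial_sum phi I a))%E.
Proof.
have [A hA] := key_estimate n0 L0 bmf_truncated_Re bmf_truncated_Im truncated_le
  truncated_orthonormal.
exists A => M I M0 hits a C hC.
pose c := real_coef I a.
have c0 i b : i \in (~: I)%SET -> c (i, b) = 0.
  by rewrite inE /c /real_coef /= => /negbTE ->.
have := hA M (~: I)%SET M0 hits c c0.
set f1 := fun x => combination c (fun z => e1 z x).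
set f2 := fun x => combination c (fun z => e2 z x).
set N := expect P (fun x => `|f1 x|) + expect P (fun x => `|f2 x|).
set D := 520 * 23 * _ in hC *.
have bf1 : bounded_measurable f1.
  apply: bmf_combination => z; apply: bmf_dir1 => *.
    exact: bmf_truncated_Re.
  exact: bmf_truncated_Im.
have bf2 : bounded_measurable f2.
  apply: bmf_combination => z; apply: bmf_dir2 => *.
    exact: bmf_truncated_Re.
  exact: bmf_truncated_Im.
have Ff : {ae P, forall x, Re (partial_sum phi I a x) = f1 x /\
                           Im (partial_sum phi I a x) = f2 x}.
  by apply: filterS ae_truncated => x h; exact: partial_sum_parts.
have mF := measurable_partial_sum I a.
rewrite (cLnorm2E mF bf1 bf2 Ff) => est.
have ge := cLnorm1_ge mF bf1 bf2 Ff; rewrite -/N in ge.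
have N0 : 0 <= N by rewrite addr_ge0 // expect_ge0.
have C0 : 0 <= C by apply: le_trans hC; rewrite mulr_ge0 ?sqrtr_ge0 // mulr_ge0 // ltW.
apply: (@le_trans _ _ (C%:E * (N / 2)%:E)%E); last by rewrite lee_wpmul2l.
rewrite -EFinM lee_fin (le_trans (ler_wsqrtr est)) //.
have LN0 : 0 <= L * N by rewrite mulr_ge0 // ltW.
rewrite mulrC sqrtrM ?sqr_ge0 // sqrtr_sqr ger0_norm //.
have := ler_wpM2r N0 hC; move: (Num.sqrt D) => r; lra.
Qed.

End ComplexSystem.

(** * The selected subsets *)

Section Selection.
Context {R : realType} {n : nat}.
Let K := (n * 2 * 2 * n.+4)%N.

Lemma card_letter : #|{: letter n n.+4}| = K.
Proof. by rewrite !card_prod !card_bool !card_ord. Qed.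

Lemma sampling_set (k : nat) (A : seq (letter n n.+4) -> 'I_n.+4 -> {set 'I_n}) :
  (0 < k)%N -> (0 < n)%N ->
  exists (M : nat) (J : {set 'I_n}), [/\ (0 < M)%N,
    M%:R <= n%:R / k%:R * ln (2 * K)%:R + 1 :> R, (#|J| <= k)%N &
    forall s y, (size s < n)%N -> (M * (size s).+1 <= #|A s y|)%N ->
      exists2 i, i \in J & i \in A s y].
Proof.
move=> k0 n0.
have k0' : 0 < k%:R :> R by rewrite ltr0n.
have K0 : (0 < K)%N by rewrite !muln_gt0 n0.
have YK : (#|'I_n.+4| <= K)%N by rewrite card_ord leq_pmull // !muln_gt0 n0.
set t : R := n%:R / k%:R * ln (2 * K)%:R.
have t0 : 0 <= t by rewrite mulr_ge0 ?divr_ge0 // ln_ge0 // ler1n muln_gt0.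
have [|J [Jk hJ]] := @random_hitting_set R _ _ n k K (Num.truncn t).+1 A n0 K0
    (eq_leq card_letter) YK.
  have -> : n%:R * ln (2 * K)%:R = k%:R * t by rewrite /t mulrA mulrCA divff ?mulr1 // gt_eqF.
  by rewrite ler_pM2l // ltW // truncnS_gt.
exists (Num.truncn t).+1, J; split => //.
by rewrite -natr1 lerD2r truncn_le.
Qed.

Lemma halving_set (A : seq (letter n n.+4) -> 'I_n.+4 -> {set 'I_n}) :
  (0 < n)%N -> ~~ odd n ->
  exists (M : nat) (I : {set 'I_n}), [/\ (0 < M)%N,
    M%:R <= 2 * (2 * ln (4 * K)%:R + 1) :> R, #|I|%:R = n%:R / 2 :> R &
    forall s y, (size s < n)%N -> (M * (size s).+1 <= #|A s y|)%N ->
      (exists2 i, i \in I & i \in A s y) /\ (exists2 i, i \in (~: I)%SET & i \in A s y)].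
Proof.
move=> n0 en.
have nE : n = n./2.*2 by rewrite -[LHS]odd_double_half (negbTE en).
have K0 : (0 < K)%N by rewrite !muln_gt0 n0.
have YK : (#|'I_n.+4| <= K)%N by rewrite card_ord leq_pmull // !muln_gt0 n0.
have K4 : (0 < 4 * K)%N by rewrite muln_gt0.
set t : R := 2 * ln (4 * K)%:R.
have t0 : 0 <= t by rewrite mulr_ge0 // ln_ge0 // ler1n.
(* Since ln 2 > 1/2, an exponent above 2 ln (4 K) is large enough. *)
have h4K : (4 * K <= 2 ^ (Num.truncn t).+1)%N.
  rewrite -(ler_nat R) natrX -ler_ln ?posrE ?exprn_gt0 ?ltr0n // lnXn // -[leRHS]mulr_natr.
  have := ltW (truncnS_gt t); have := @ln2_gt_twothirds R.
  move=> h1 h2; apply: (@le_trans _ _ (1 / 2 * (Num.truncn t).+1%:R)).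
    by move: h2; rewrite {1}/t; lra.
  by rewrite ler_wpM2r //; lra.
have [I [cI hI]] := random_halving A nE K0 (eq_leq card_letter) YK h4K.
exists (2 * (Num.truncn t).+1)%N, I; split => //.
- by rewrite natrM ler_wpM2l // -natr1 lerD2r truncn_le.
- by rewrite cI {2}nE -muln2 natrM mulfK.
Qed.

End Selection.

Theorem theorem3 (R : realType) :
  exists c C : R, 0 < c /\ 0 < C /\
  forall (n : nat) (L : R), (0 < n)%N -> 0 < L ->
  forall (d : measure_display) (T : measurableType d) (P : probability T R)
    (phi : 'I_n -> T -> R[i]),
  orthonormal_system P phi ->
  (forall j : 'I_n, (cLnorm P +oo%E (phi j) <= L%:E)%E) ->
  (forall k : nat, (1 < k)%N -> (k < n)%N ->
    exists I : {set 'I_n}, (n - k <= #|I|)%N /\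
      forall a : 'I_n -> R[i],
        let mu : R := L * Num.sqrt (n%:R / k%:R) * Num.sqrt (ln k%:R) in
        (cLnorm P 2%:E (partial_sum phi I a)
         <= (C * mu * (ln mu `^ (5 / 2)))%:E
            * cLnorm P 1%:E (partial_sum phi I a))%E)
  /\
  ((4 <= n)%N -> ~~ odd n ->
    exists I : {set 'I_n},
      n%:R / 2 - c * Num.sqrt n%:R <= (#|I|%:R : R) /\
      (#|I|%:R : R) <= n%:R / 2 + c * Num.sqrt n%:R /\
      forall a : 'I_n -> R[i],
        (cLnorm P 2%:E (partial_sum phi I a)
         <= (C * L * Num.sqrt (ln n%:R) * (ln (ln n%:R) `^ (5 / 2)))%:E
            * cLnorm P 1%:E (partial_sum phi I a))%E /\
        (cLnorm P 2%:E (partial_sum phi (~: I) a)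
         <= (C * L * Num.sqrt (ln n%:R) * (ln (ln n%:R) `^ (5 / 2)))%:E
            * cLnorm P 1%:E (partial_sum phi (~: I) a))%E).
Proof.
have D0 : 0 < 520 * 23 :> R by apply: mulr_gt0; rewrite ltr0n.
have [C1 C10 hC1] := sampling_constant D0.
have [C2 C20 hC2] := halving_constant D0.
(* The halving set has exactly n/2 elements, so any positive [c] does; [C1] serves sampling and [C2]
   halving. *)
exists 1, (C1 + C2); split; first exact: ltr01.
split=> [|n L n0 L0 d T P phi phiO phiL]; first exact: addr_gt0.
have [A hA] := complex_key_estimate n0 L0 phiO phiL.
have L1 := L_ge1 n0 L0 phiO phiL.
split=> [k k1 kn|n4 en].
  have [M [J [M0 hM Jk hJ]]] := @sampling_set R n k A (ltnW k1) n0.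
  exists (~: J)%SET; split.
    rewrite leq_subLR -[X in (X <= _)%N](card_ord n) -(cardsC J).
    by rewrite leq_add2r.
  move=> a /=; apply: (hA M) => //; first by rewrite finset.setCK.
  have /= [mu0 h] := hC1 n k M L k1 kn L1 M0 hM.
  apply: (le_trans h); rewrite -[leLHS]mulrA -[leRHS]mulrA.
  by rewrite (ler_wpM2r mu0) // lerDl ltW.
have [M [I [M0 hM cI hI]]] := @halving_set R n A n0 en.
have sq0 : 0 <= Num.sqrt n%:R :> R by exact: sqrtr_ge0.
have h := hC2 n M L n4 (ltW L0) M0 hM.
have {}h : 2 * L * Num.sqrt (520 * 23 * (M%:R * (1 + ln M%:R))) <=
    (C1 + C2) * L * Num.sqrt (ln n%:R) * (ln (ln n%:R) `^ (5 / 2)).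
  apply: (le_trans h); rewrite -!mulrA ler_wpM2r ?lerDr ?(ltW C10) //.
  by rewrite mulr_ge0 ?(ltW L0) // mulr_ge0 ?sqrtr_ge0 // powR_ge0.
exists I; rewrite cI; split; first by rewrite mul1r gerBl.
split; first by rewrite mul1r lerDl.
move=> a; split; apply: (hA M) => // s y sn hs; have [h1 h2] := hI s y sn hs => //.
by rewrite finset.setCK.
Qed.
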